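(* Let $T$ be an equilateral compact metric tree rooted at $v_0$, with edges of length $\ell>0$ and real-valued potentials $q_j\in L^2(0,\ell)$, and let $T_\infty$ be obtained from $T$ by attaching a half-infinite lead $e_0=[0,\infty)$ at $v_0$ with potential $q_0=0$ on $e_0$. Then the multiplicity of a negative eigenvalue $\lambda_0\in\mathrm{Sp}(L_\infty)$ is equal to the multiplicity of $\sqrt{\lambda_0}$ (with $\operatorname{Im}\sqrt{\lambda_0}>0$) as a root of the Jost function $\sqrt\lambda\mapsto E(\sqrt\lambda)=\phi_N(\lambda)+i\sqrt\lambda\,\phi_D(\lambda)$.
   Context: Tree. $T$ is a finite metric tree with $p\ge2$ vertices and $g=p-1$ edges $e_1,\dots,e_g$, all of length $\ell>0$, with a chosen vertex $v_0$ as root. $d(v)$ is the degree of $v$ in $T$ (the lead is not counted). Edges are directed away from the root and each is identified with $[0,\ell]$, $x=0$ being its initial vertex; each vertex $v\ne v_0$ has exactly one incoming edge. The edges outgoing from $v_0$ are $e_1,\dots,e_{d(v_0)}$. On $e_j$ consider $-y_j''+q_jy_j=\lambda y_j$. Vertex conditions. Standard conditions at $v\neq v_0$ with incoming edge $e_j$: $y_j'(\ell)=0$ if $v$ is pendant; if $v$ is interior, $y_j(\ell)=y_k(0)$ for every edge $e_k$ outgoing from $v$ and $y_j'(\ell)=\sum_k y_k'(0)$, the sum being over edges outgoing from $v$. Standard conditions at $v_0$ in $T$: $y_1(0)=y_k(0)$ for $k=2,\dots,d(v_0)$ and $\sum_{k=1}^{d(v_0)}y_k'(0)=0$. Dirichlet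 condition at $v_0$: $y_k(0)=0$, $k=1,\dots,d(v_0)$. Operator $L_\infty$. In $L^2(T_\infty)=L^2(0,\infty)\oplus\bigoplus_{j=1}^gL^2(0,\ell)$, $L_\infty(y_j)_{j=0}^g=(-y_j''+q_jy_j)_{j=0}^g$ with $q_0=0$, and domain all $(y_j)_{j=0}^g\in H^2(0,\infty)\oplus\bigoplus_{j=1}^gH^2(0,\ell)$ satisfying the standard conditions at all $v\ne v_0$ and, at $v_0$, $y_0(0)=y_k(0)$, $k=1,\dots,d(v_0)$, and $\sum_{k=0}^{d(v_0)}y_k'(0)=0$. $L_\infty$ is self-adjoint, and the multiplicity of an eigenvalue $\lambda_0$ is $\dim\ker(L_\infty-\lambda_0)$. $\mathrm{Sp}$ denotes the spectrum. Characteristic functions. Let $c_j(\sqrt\lambda,x)$, $s_j(\sqrt\lambda,x)$ solve the equation on $e_j$ with $c_j=1,c_j'=0$ and $s_j=0,s_j'=1$ at $x=0$. Writing $y_j=a_jc_j+b_js_j$, the vertex conditions on $T$ become a $2g\times2g$ linear system for $(a_1,\dots,a_g,b_1,\dots,b_g)^\top$ with matrix $\Phi_D(\lambda)$ (Dirichlet at $v_0$, standard at all other vertices) or $\Phi_N(\lambda)$ (standard at all vertices). The first $d(v_0)$ rows express $a_1=0,\dots,a_{d(v_0)}=0$ for $\Phi_D$, and $a_1-a_2=0,\dots,a_1-a_{d(v_0)}=0$, $b_1+\dots+b_{d(v_0)}=0$ for $\Phi_N$; the remaining rows, identical and in the same order for both, express the conditions $y_j(\ell)-y_k(0)=0$ and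 $y_j'(\ell)-\sum_ky_k'(0)=0$ at the vertices $v\neq v_0$. Set $\phi_D=\det\Phi_D$, $\phi_N=\det\Phi_N$; these are entire functions of $\lambda$. $E$ is regarded as an entire function of the complex variable $\zeta=\sqrt\lambda$, $E(\zeta)=\phi_N(\zeta^2)+i\zeta\phi_D(\zeta^2)$, and multiplicities of its zeros are with respect to $\zeta$. *)

(* Defs.v *)
From mathcomp Require Import all_boot all_order all_algebra all_fingroup.
From mathcomp Require Import all_classical all_reals all_analysis.
From mathcomp Require Import complex.

Set Implicit Arguments.
Unset Strict Implicit.
Unset Printing Implicit Defensive.

Import Order.TTheory GRing.Theory Num.Theory.
Import numFieldNormedType.Exports.

Local Open Scope classical_set_scope.
Local Open Scope ring_scope.
Local Open Scope complex_scope.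

(* A combinatorial tree with p vertices and p - 1 edges, with root [tree_root],
   whose edges are oriented away from the root and numbered so that the edges leaving
   the root come first; the edge e_(j+1) is represented by j : 'I_p.-1. *)

Definition tree_adj (V : finType) (g : nat) (src tgt : 'I_g -> V) : rel V :=
  [rel u v | [exists j, (src j == u) && (tgt j == v)
                     || (src j == v) && (tgt j == u)]].

Definition vdegree (V : finType) (g : nat) (src tgt : 'I_g -> V) (v : V) : nat :=
  #|[set j | (src j == v) || (tgt j == v)]%SET|.

Record rooted_tree (p : nat) := RootedTree {
  vertex : finType;
  tree_root : vertex;
  src : 'I_p.-1 -> vertex;
  tgt : 'I_p.-1 -> vertex;
  card_vertex : #|{: vertex}| = p;
  tree_no_loop : forall j, src j != tgt j;
  tree_no_parallel : forall j k,
    [set src j; tgt j]%SET = [set src k; tgt k]%SET -> j = k;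
  tree_connected : forall u v, connect (tree_adj src tgt) u v;
  (* ucycle counts a single edge run back and forth as a cycle of size 2 *)
  tree_acyclic : forall s, ucycle (tree_adj src tgt) s -> (size s <= 2)%N;
  (* every edge points away from the root: its initial vertex can be reached
     from the root without passing through its terminal vertex *)
  tree_away : forall j, exists s : seq vertex,
    [/\ path (tree_adj src tgt) tree_root s, last tree_root s = src j
      & tgt j \notin tree_root :: s];
  tree_root_first : forall j : 'I_p.-1,
    (src j == tree_root) = (j < vdegree src tgt tree_root)%N
}.

Definition degree (p : nat) (T : rooted_tree p) (v : vertex T) : nat :=
  vdegree (@src p T) (@tgt p T) v.

Section Sobolev.
Variable R : realType.
Local Notation mu := (@lebesgue_measure R).

Definition L2_real (A : set R) (f : R -> R) : Prop :=
  measurable_fun A f /\ mu.-integrable A (fun x => (f x ^+ 2)%:E).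

Definition L2_complex (A : set R) (f : R -> R[i]) : Prop :=
  L2_real A (fun x => complex.Re (f x)) /\ L2_real A (fun x => complex.Im (f x)).

Definition Cintegral (A : set R) (f : R -> R[i]) : R[i] :=
  (\int[mu]_(x in A) complex.Re (f x))%R +i*
  (\int[mu]_(x in A) complex.Im (f x))%R.

(* [H2 A y dy ddy], for A = [0, l] or A = [0, +oo[ : y is (the continuously
   differentiable representative of) an element of H^2(A) whose derivatives are
   dy (absolutely continuous) and ddy (determined almost everywhere).  Only the
   values on A matter. *)
Definition H2 (A : set R) (y dy ddy : R -> R[i]) : Prop :=
  [/\ L2_complex A y, L2_complex A dy, L2_complex A ddy,
      forall x, A x -> y x = y 0 + Cintegral `[0, x] dy
    & forall x, A x -> dy x = dy 0 + Cintegral `[0, x] ddy].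

(* Since q is in L^2(0, l), the solutions of -y'' + q y = lam y on [0, l] in the
   sense of Caratheodory are in H^2(0, l), with dy the derivative of y. *)
Definition schrodinger_solution (l : R) (q : R -> R) (lam : R[i])
    (y dy : R -> R[i]) : Prop :=
  exists ddy : R -> R[i], H2 `[0, l] y dy ddy /\
    {ae mu, forall x, `[0, l]%classic x ->
       - ddy x + (q x)%:C * y x = lam * y x}.

Definition fundamental_system (l : R) (q : R -> R) (lam : R[i])
    (c dc s ds : R -> R[i]) : Prop :=
  [/\ schrodinger_solution l q lam c dc, c 0 = 1 & dc 0 = 0] /\
  [/\ schrodinger_solution l q lam s ds, s 0 = 0 & ds 0 = 1].

End Sobolev.

Section Operator.
Variables (R : realType) (p : nat) (T : rooted_tree p) (l : R).
Local Notation mu := (@lebesgue_measure R).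
Local Notation g := p.-1.

(* The edges of T_infinity: None is the lead e_0, Some j an edge of T. *)
Definition edge_interval (k : option 'I_g) : set R :=
  if k is Some _ then `[0, l]%classic else `[0, +oo[%classic.

(* A family of functions on the edges of T_infinity; only the values of y k on
   edge_interval k matter. *)
Definition edge_family := option 'I_g -> R -> R[i].

Definition edge_ae_eq (y z : edge_family) : Prop :=
  forall k, {ae mu, forall x, edge_interval k x -> y k x = z k x}.

(* Standard conditions at the vertices other than the root; at a pendant vertex
   the sum is empty and the condition reads y_j'(l) = 0. *)
Definition inner_conditions (y dy : edge_family) : Prop :=
  (forall j k : 'I_g, tgt T j = src T k -> y (Some j) l = y (Some k) 0) /\
  (forall j : 'I_g, dy (Some j) l = \sum_(k | src T k == tgt T j) dy (Some k) 0).

Definition lead_root_conditions (y dy : edge_family) : Prop :=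
  (forall k : 'I_g, src T k = tree_root T -> y None 0 = y (Some k) 0) /\
  dy None 0 + \sum_(k | src T k == tree_root T) dy (Some k) 0 = 0.

Definition lead_potential (q : 'I_g -> R -> R) (k : option 'I_g) : R -> R :=
  if k is Some j then q j else (fun=> 0).

(* The graph of L_infinity: y is in the domain and L_infinity y = z in
   L^2(T_infinity), y being given by its continuous representative. *)
Definition Linfty_graph (q : 'I_g -> R -> R) (y z : edge_family) : Prop :=
  exists dy ddy : edge_family,
    [/\ forall k, H2 (edge_interval k) (y k) (dy k) (ddy k),
        inner_conditions y dy, lead_root_conditions y dy
      & forall k, {ae mu, forall x, edge_interval k x ->
          z k x = - ddy k x + (lead_potential q k x)%:C * y k x}].

Definition Linfty_ker (q : 'I_g -> R -> R) (lam : R[i]) (y : edge_family) : Prop :=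
  Linfty_graph q y (fun k x => lam * y k x).

Definition Linfty_eigenvalue (q : 'I_g -> R -> R) (lam : R[i]) : Prop :=
  exists y, Linfty_ker q lam y /\ ~ edge_ae_eq y (fun _ _ => 0).

Definition lincomb (m : nat) (b : 'I_m -> edge_family) (a : 'I_m -> R[i]) :
    edge_family :=
  fun k x => \sum_(i < m) a i * b i k x.

(* dim ker (L_infinity - lam) = m, as a subspace of L^2(T_infinity). *)
Definition Linfty_ker_dim (q : 'I_g -> R -> R) (lam : R[i]) (m : nat) : Prop :=
  exists b : 'I_m -> edge_family,
    [/\ forall i, Linfty_ker q lam (b i),
        forall a : 'I_m -> R[i],
          edge_ae_eq (lincomb b a) (fun _ _ => 0) -> forall i, a i = 0
      & forall y, Linfty_ker q lam y ->
          exists a : 'I_m -> R[i], edge_ae_eq y (lincomb b a)].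

End Operator.

Section Jost.
Variables (R : realType) (p : nat) (T : rooted_tree p) (l : R).
Local Notation g := p.-1.
Local Notation d := (degree (tree_root T)).

(* Linear forms in the unknowns (a_1, ..., a_g, b_1, ..., b_g), as row vectors,
   where y_j = a_j c_j + b_j s_j; [coef_a n] is a_(n+1) = y_(n+1)(0) and
   [coef_b n] is b_(n+1) = y'_(n+1)(0). *)
Definition coef_a (n : nat) : 'rV[R[i]]_(g + g) :=
  \row_i ((i == n :> nat)%:R).
Definition coef_b (n : nat) : 'rV[R[i]]_(g + g) :=
  \row_i ((i == (g + n)%N :> nat)%:R).

(* [u j] and [v j] are the values at x = l of c_j and s_j (of their derivatives,
   in kirchhoff_row). *)
Definition end_form (u v : 'I_g -> R[i]) (j : 'I_g) : 'rV[R[i]]_(g + g) :=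
  u j *: coef_a j + v j *: coef_b j.

(* y_j(l) - y_k(0), where e_j is the only edge entering the initial vertex of
   e_k, supposed different from the root *)
Definition continuity_row (c s : 'I_g -> R[i]) (k : 'I_g) : 'rV[R[i]]_(g + g) :=
  \sum_(j | tgt T j == src T k) end_form c s j - coef_a k.

Definition kirchhoff_row (dc ds : 'I_g -> R[i]) (j : 'I_g) : 'rV[R[i]]_(g + g) :=
  end_form dc ds j - \sum_(k | src T k == tgt T j) coef_b k.

Definition dirichlet_root_row (k : nat) : 'rV[R[i]]_(g + g) := coef_a k.

Definition standard_root_row (k : nat) : 'rV[R[i]]_(g + g) :=
  if (k.+1 < d)%N then coef_a 0 - coef_a k.+1 else \sum_(n < d) coef_b n.

(* The first d(v_0) rows are the given conditions at the root.  Every e_k with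
   k > d(v_0) contributes a continuity row, and the terminal vertex of every
   e_j a Kirchhoff row. *)
Definition Phi (root_row : nat -> 'rV[R[i]]_(g + g))
    (c dc s ds : 'I_g -> R[i]) : 'M[R[i]]_(g + g) :=
  \matrix_(i, n)
    (match fintype.split i with
     | inl k => if (k < d)%N then root_row k else continuity_row c s k
     | inr j => kirchhoff_row dc ds j
     end) 0 n.

(* [c j lam x] is c_j(sqrt lam, x) and [dc j lam x] its derivative in x, and
   likewise for s, ds.  The permutation [sigma], meant to fix the first d(v_0)
   indices, accounts for the arbitrary order of the remaining rows, which is the
   same for phi_D and phi_N. *)
Definition phi (root_row : nat -> 'rV[R[i]]_(g + g)) (sigma : 'S_(g + g))
    (c dc s ds : 'I_g -> R[i] -> R -> R[i]) (lam : R[i]) : R[i] :=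
  \det (row_perm sigma (Phi root_row (fun j => c j lam l) (fun j => dc j lam l)
                                  (fun j => s j lam l) (fun j => ds j lam l))).

Definition phi_D := phi dirichlet_root_row.
Definition phi_N := phi standard_root_row.

Definition jost (sigma : 'S_(g + g)) (c dc s ds : 'I_g -> R[i] -> R -> R[i])
    (zeta : R[i]) : R[i] :=
  phi_N sigma c dc s ds (zeta ^+ 2) +
  (0 +i* 1) * zeta * phi_D sigma c dc s ds (zeta ^+ 2).

End Jost.

(* The order of z0 as a zero of E, used for K = R[i], where differentiability near
   z0 is holomorphy. *)
Definition root_multiplicity (K : numFieldType) (E : K -> K) (z0 : K)
    (n : nat) : Prop :=
  exists h : K -> K,
    [/\ \forall z \near z0, derivable h z 1, h z0 != 0
      & \forall z \near z0, E z = (z - z0) ^+ n * h z].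

(* Main.v *)
Require Import Defs.
From mathcomp Require Import all_boot all_order all_algebra all_fingroup.
From mathcomp Require Import all_classical all_reals all_analysis.
From mathcomp Require Import complex.
From mathcomp Require Import measurable_realfun ring lra.
Import Order.TTheory GRing.Theory Num.Theory.
Import numFieldNormedType.Exports.
Set Implicit Arguments.
Unset Strict Implicit.
Unset Printing Implicit Defensive.
Local Open Scope classical_set_scope.
Local Open Scope ring_scope.
Local Open Scope complex_scope.

(** Let e^(i zeta x), with Im zeta > 0, be the solution that the lead allows.
Continuing a function on the tree by a multiple of it turns the conditions of
L_infinity at the root into continuity and sum_k y_k'(0) + i zeta y(0) = 0.  This
is visible in E.  The Dirichlet rows
a_0, ..., a_(d-1) can be replaced, without changing the determinant, by
a_0 - a_1, ..., a_0 - a_(d-1), a_0 (repeated use of [det_sub_swap]); then phi_N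
and phi_D differ in one row only, and E(zeta) is, up to the sign of sigma, the
determinant of a single matrix M(zeta) whose last root row is
sum_k b_k + i zeta a_0 ([jost_det]).  At zeta_0 = i kappa, where
lambda_0 = - kappa^2, the kernel of M(zeta_0) is the space of initial data of
the functions in ker (L_infinity - lambda_0) ([mode_ker], [ker_mode]): on the
edges they are a_j c_j + b_j s_j, and on the lead square integrability leaves
only the decaying exponential.  So the geometric multiplicity is
m = dim ker M(zeta_0) ([ker_dim]).

It remains to see that det M has a zero of order exactly m at zeta_0.  Write
M(zeta) = M(zeta_0) + (zeta - zeta_0) N(zeta).  In a basis of initial data
whose last m vectors span ker M(zeta_0), the last m columns of M(zeta) are
divisible by zeta - zeta_0; hence det M(zeta) = (zeta - zeta_0)^m h(zeta)
([det_kernel_factor]), and h(zeta_0) <> 0 as soon as M(zeta_0) has no Jordan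
chain of length two: M(zeta_0) v = 0 and N(zeta_0) v + M(zeta_0) w = 0 force
v = 0 ([det_kernel_factor_neq0]).  For such a pair, let y be the function with
initial data v, and u the sum of the zeta-derivative of y and of the function
with initial data w.  Then - u'' + q u - lambda_0 u = 2 zeta_0 y, and Green's
formula for u and the conjugate of y, where all the inner vertices cancel
([green_tree]), gives 2 zeta_0 sum_j int |y_j|^2 = - i |y(v_0)|^2.  As
zeta_0 = i kappa with kappa > 0, both sides vanish, so y = 0 and v = 0
([no_jordan_chain]).

The analysis behind this is done on one edge.  Products of absolutely
continuous functions are integrated by parts with Fubini's theorem, which gives
the Wronskian identity W(y, z)' = (lambda - nu) y z for solutions at lambda and
nu ([wronskianE]).  It implies that c and s span the solutions, and the formula
Y_lambda = Y_nu + (lambda - nu) K Y_lambda with a bounded operator K that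
depends on nu only ([solution_duhamel], [parameter_expansion]).  Since the
formula holds with every nu, it yields a local bound for Y_lambda, then the
complex differentiability of lambda |-> L(Y_lambda) for every bounded functional
L ([functional_cdiff]).  The entries of N are built from such functions, so h is
differentiable. *)

(** * Integration by parts for absolutely continuous functions *)

Section IBP.
Variable R : realType.
Local Notation mu := (@lebesgue_measure R).
Implicit Types (a b f g : R -> R) (x : R).

Lemma integrable_subitv f x y : x <= y ->
  mu.-integrable `[0, y] (EFin \o f) -> mu.-integrable `[0, x] (EFin \o f).
Proof.
move=> xy; apply: integrableS => //=.
by apply: subset_itvl; rewrite bnd_simp.
Qed.

(** Fubini's theorem for a(t) b(s) on the triangle s <= t. It is all that
integration by parts needs, and it also yields the integrability of a times a
primitive of b. *)
Lemma Rintegral_swap_triangle a b x :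
  mu.-integrable `[0, x] (EFin \o a) -> mu.-integrable `[0, x] (EFin \o b) ->
  mu.-integrable `[0, x] (fun t => (a t * \int[mu]_(s in `[0, t]) b s)%:E) /\
  \int[mu]_(t in `[0, x]) (a t * \int[mu]_(s in `[0, t]) b s) =
  \int[mu]_(s in `[0, x]) (b s * \int[mu]_(t in `[s, x]) a t).
Proof.
move=> ia ib.
pose a' := a \_ `[0, x]; pose b' := b \_ `[0, x].
have ia' : mu.-integrable setT (EFin \o a').
  by rewrite /a' -restrict_EFin; apply/(integrable_mkcond _ _).1.
have ib' : mu.-integrable setT (EFin \o b').
  by rewrite /b' -restrict_EFin; apply/(integrable_mkcond _ _).1.
have ma' : measurable_fun setT a' by apply/measurable_EFinP; exact: measurable_int ia'.
have mb' : measurable_fun setT b' by apply/measurable_EFinP; exact: measurable_int ib'.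
pose h (z : R * R) := if z.2 <= z.1 then a' z.1 * b' z.2 else 0.
have mh : measurable_fun setT h.
  apply: measurable_fun_ifT => //.
    by apply: measurable_fun_ler; [exact: measurable_snd|exact: measurable_fst].
  by apply: measurable_funM; [exact: (measurableT_comp ma' measurable_fst)|
                              exact: (measurableT_comp mb' measurable_snd)].
have ih : (mu \x mu)%E.-integrable setT (EFin \o h).
  apply/integrable12ltyP; first exact/measurable_EFinP.
  apply: (@le_lt_trans _ _ (\int[mu]_t ((`|a' t|)%:E * \int[mu]_s (`|b' s|)%:E))%E).
    apply: ge0_le_integral => //.
    - by move=> t _; apply: integral_ge0.
    - have mah : measurable_fun setT (abse \o (EFin \o h)).
        by apply/measurable_EFinP/measurableT_comp.
      by apply: (@measurable_fun_fubini_tonelli_F _ _ _ _ _ mu _ mah) => z;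
        exact: abse_ge0.
    - by apply: emeasurable_funM => //; apply/measurable_EFinP/measurableT_comp.
    - move=> t _; rewrite -ge0_integralZl//; last first.
        by apply/measurable_EFinP/measurableT_comp.
      apply: ge0_le_integral => //.
      + apply/measurable_EFinP/measurableT_comp => //.
        exact: (measurableT_comp mh (measurable_pair1 _)).
      + by apply/measurable_EFinP/measurable_funM => //; exact/measurableT_comp.
      + by move=> s _; rewrite -EFinM lee_fin /h /=; case: ifP;
          rewrite ?normrM// normr0 mulr_ge0.
  rewrite ge0_integralZr//; [|by apply/measurable_EFinP/measurableT_comp|
                              by apply: integral_ge0].
  by case/integrableP : ia' => _ ?; case/integrableP : ib' => _ ?;
    apply: lte_mul_pinfty; rewrite ?integral_ge0// ge0_fin_numE// integral_ge0.
have inner1 t : (\int[mu]_s (EFin \o h) (t, s))%E =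
    (((fun t => a t * \int[mu]_(s in `[0, t]) b s) \_ `[0, x]) t)%:E.
  rewrite /= patchE; case: ifPn => tx; last first.
    under eq_integral => s _.
      by rewrite /h/= /a' patchE (negbTE tx) mul0r if_same; over.
    by rewrite integral0.
  have tx' := tx; rewrite inE/= in_itv/= in tx'.
  have ibt : mu.-integrable `[0, t] (EFin \o b).
    by apply: integrable_subitv ib; case/andP : tx'.
  rewrite EFinM /Rintegral fineK; last exact: integrable_fin_num.
  rewrite -integralZl// [RHS]integral_mkcond; apply: eq_integral => s _.
  rewrite /h /= /a' /b' !patchE tx; case: ifPn => st.
    rewrite [X in if X then _ else _](_ : _ = (s \in `[0%R, t]%classic)).
      by case: ifP => // _; rewrite mulr0.
    case/andP : tx' => _ tx'; rewrite !mem_setE !in_itv/= st andbT.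
    by rewrite (le_trans st tx') andbT.
  by case: ifPn => //; rewrite mem_setE in_itv/= (negbTE st) andbF.
have inner2 s : (\int[mu]_t (EFin \o h) (t, s))%E =
    (((fun s => b s * \int[mu]_(t in `[s, x]) a t) \_ `[0, x]) s)%:E.
  rewrite /= patchE; case: ifPn => sx; last first.
    under eq_integral => t _.
      by rewrite /h/= /b' patchE (negbTE sx) mulr0 if_same; over.
    by rewrite integral0.
  have sx' := sx; rewrite inE/= in_itv/= in sx'.
  have ias : mu.-integrable `[s, x] (EFin \o a).
    apply: integrableS ia => //; apply: subset_itvr; rewrite bnd_simp.
    by case/andP : sx'.
  rewrite EFinM /Rintegral fineK; last exact: integrable_fin_num.
  rewrite -integralZl// [RHS]integral_mkcond; apply: eq_integral => t _.
  rewrite /h /= /a' /b' !patchE sx; case: ifPn => st.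
    rewrite [X in if X then _ else _](_ : _ = (t \in `[s, x]%classic)).
      by case: ifP => // _; rewrite ?mul0r// mulrC.
    case/andP : sx' => sx' _; rewrite !mem_setE !in_itv/= st /=.
    by rewrite (le_trans sx' st).
  by case: ifPn => //; rewrite mem_setE in_itv/= (negbTE st).
split.
  have := integrable_fubini_F ih; rewrite /fubini_F (_ : (fun _ => _) =
    ((fun t => (a t * \int[mu]_(s in `[0, t]) b s)%:E) \_ `[0, x])).
    by move/(integrable_mkcond _ _).2; exact.
  by apply/funext => t; rewrite inner1 restrict_EFin.
rewrite [LHS]Rintegral_mkcond [RHS]Rintegral_mkcond /Rintegral; congr fine.
transitivity (\int[mu]_t \int[mu]_s (EFin \o h) (t, s))%E.
  by apply: eq_integral => t _; rewrite inner1.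
by rewrite Fubini//; apply: eq_integral => s _; rewrite inner2.
Qed.

Lemma integrable_scale (A : set R) k f : measurable A ->
  mu.-integrable A (EFin \o f) -> mu.-integrable A (EFin \o (fun x => k * f x)).
Proof.
move=> mA fi; rewrite (_ : _ \o _ = fun x => (k%:E * (EFin \o f) x)%E)//.
exact: integrableZl.
Qed.

Lemma integrable_plus (A : set R) f g : measurable A ->
  mu.-integrable A (EFin \o f) -> mu.-integrable A (EFin \o g) ->
  mu.-integrable A (EFin \o (fun x => f x + g x)).
Proof.
move=> mA fi gi; rewrite (_ : _ \o _ = ((EFin \o f) \+ (EFin \o g))%E)//.
exact: integrableD.
Qed.

Lemma integrable_congr (A : set R) f g : measurable A ->
  {in A, f =1 g} ->
  mu.-integrable A (EFin \o f) -> mu.-integrable A (EFin \o g).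
Proof.
by move=> mA fg; apply: eq_integrable => // x xA /=; rewrite fg.
Qed.

(** Absolute continuity on [0, l], with derivative df, in integrated form. *)
Definition has_density (l : R) f df : Prop :=
  mu.-integrable `[0, l] (EFin \o df) /\
  forall x, x \in `[0, l] -> f x = f 0 + \int[mu]_(t in `[0, x]) df t.

Lemma has_density_subitv l m f df : m <= l -> has_density l f df ->
  has_density m f df.
Proof.
move=> ml [idf fE]; split; first exact: integrable_subitv idf.
by move=> x; rewrite in_itv/= => /andP[x0 xm]; apply: fE;
  rewrite in_itv/= x0 (le_trans xm).
Qed.

(** Both claims come from writing f as f(0) plus a primitive of its derivative.
*)
Lemma integrable_mul_density l h f df :
  mu.-integrable `[0, l] (EFin \o h) -> has_density l f df ->
  mu.-integrable `[0, l] (EFin \o (h \* f)) /\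
  \int[mu]_(x in `[0, l]) (h x * f x) =
    f 0 * \int[mu]_(x in `[0, l]) h x +
    \int[mu]_(x in `[0, l]) (h x * \int[mu]_(t in `[0, x]) df t).
Proof.
move=> ih [idf fE]; have [iP _] := Rintegral_swap_triangle ih idf.
have ifh : mu.-integrable `[0, l] (EFin \o (fun x => f 0 * h x)).
  exact: integrable_scale.
have E x : x \in `[0, l]%classic ->
    h x * f x = f 0 * h x + h x * \int[mu]_(t in `[0, x]) df t.
  by rewrite mem_setE => xl; rewrite fE// mulrDr mulrC.
split.
  apply: integrable_congr (integrable_plus _ ifh iP) => // x xl.
  by rewrite /= -E.
by rewrite -RintegralZl// -RintegralD//; exact: eq_Rintegral.
Qed.

(** Integration by parts: the two double integrals in int f' g and int f g' run
over complementary triangles, and together fill the square. *)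
Lemma has_densityM l f df g dg : has_density l f df -> has_density l g dg ->
  has_density l (fun x => f x * g x) (fun x => df x * g x + f x * dg x).
Proof.
move=> df' dg'; have i1 m : m <= l -> _ := fun h =>
  integrable_mul_density (has_density_subitv h df').1 (has_density_subitv h dg').
have i2 m : m <= l -> _ := fun h =>
  integrable_mul_density (has_density_subitv h dg').1 (has_density_subitv h df').
have i2' m : m <= l -> mu.-integrable `[0, m] (EFin \o (f \* dg)).
  by move=> /i2[+ _]; apply: eq_integrable => //= x _; rewrite mulrC.
split.
  by apply: integrable_plus => //; [have [] := i1 l (lexx l)|exact: i2'].
move=> x xl; have xl' := xl; move: xl; rewrite in_itv/= => /andP[x0 xl].
have [i1x E1] := i1 x xl; have [i2x E2] := i2 x xl.
rewrite RintegralD//=; last exact: i2'.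
have -> : \int[mu]_(t in `[0, x]) (f t * dg t) = \int[mu]_(t in `[0, x]) (dg t * f t).
  by apply: eq_Rintegral => t _; rewrite mulrC.
rewrite E1 E2.
have idf := (has_density_subitv xl df').1; have idg := (has_density_subitv xl dg').1.
have [iF _] := Rintegral_swap_triangle idg idf.
have [_ ->] := Rintegral_swap_triangle idf idg.
have -> : \int[mu]_(s in `[0, x]) (dg s * \int[mu]_(t in `[s, x]) df t) =
   \int[mu]_(s in `[0, x]) ((\int[mu]_(t in `[0, x]) df t) * dg s -
                           dg s * \int[mu]_(t in `[0, s]) df t).
  apply: eq_Rintegral => s; rewrite mem_setE in_itv/= => /andP[s0 sx].
  rewrite [X in _ = X - _]mulrC -mulrBr Rintegral_itvB ?bnd_simp//.
  rewrite Rintegral_itv_obnd_cbnd//.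
  apply: integrableS idf => //; apply: subset_itvr; rewrite bnd_simp//.
rewrite RintegralB//=; last first.
  exact: integrable_scale.
rewrite RintegralZl// (df'.2 x)// (dg'.2 x)//; ring.
Qed.

Lemma has_densityD l f df g dg : has_density l f df -> has_density l g dg ->
  has_density l (fun x => f x + g x) (fun x => df x + dg x).
Proof.
move=> [idf fE] [idg gE]; split.
  exact: integrable_plus.
move=> x xl; rewrite fE// gE// RintegralD//; first by ring.
- by apply: integrable_subitv idf; move: xl; rewrite in_itv/= => /andP[].
- by apply: integrable_subitv idg; move: xl; rewrite in_itv/= => /andP[].
Qed.

Lemma has_densityZ l k f df : has_density l f df ->
  has_density l (fun x => k * f x) (fun x => k * df x).
Proof.
move=> [idf fE]; split.
  exact: integrable_scale.
move=> x xl; rewrite fE// RintegralZl// ?mulrDr//.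
by apply: integrable_subitv idf; move: xl; rewrite in_itv/= => /andP[].
Qed.

Lemma has_density_bounded l f df : has_density l f df ->
  exists M, forall x, x \in `[0, l] -> `|f x| <= M.
Proof.
move=> [idf fE]; exists (`|f 0| + \int[mu]_(x in `[0, l]) `|df x|) => x xl.
have xl' : x <= l by move: xl; rewrite in_itv/= => /andP[].
rewrite fE//; apply: (le_trans (ler_normD _ _)); rewrite lerD2l.
have idfx : mu.-integrable `[0, x] (EFin \o df) by exact: integrable_subitv idf.
apply: le_trans (le_normr_Rintegral _ idfx) _ => //.
rewrite -lee_fin /Rintegral !fineK; try exact/integrable_fin_num/integrable_norm.
apply: ge0_subset_integral => //=.
- by apply: (measurable_int mu); exact/integrable_norm.
- by apply: subset_itvl; rewrite bnd_simp.
Qed.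
End IBP.

(** * Complex-valued integrals *)

Section ComplexIntegral.
Variable R : realType.
Local Notation mu := (@lebesgue_measure R).
Local Notation C := R[i].
Local Notation Re := complex.Re.
Local Notation Im := complex.Im.
Implicit Types (f g : R -> C) (A : set R).

Lemma ae_imply (P Q : R -> Prop) : (forall x, P x -> Q x) ->
  {ae mu, forall x, P x} -> {ae mu, forall x, Q x}.
Proof.
move=> PQ; apply: filterS => //.
exact: (ae_filter_ringOfSetsType (@lebesgue_measure R)).
Qed.

Lemma ae_imply2 (P Q S : R -> Prop) : (forall x, P x -> Q x -> S x) ->
  {ae mu, forall x, P x} -> {ae mu, forall x, Q x} -> {ae mu, forall x, S x}.
Proof.
move=> PQ; apply: filterS2 => //.
exact: (ae_filter_ringOfSetsType (@lebesgue_measure R)).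
Qed.

Lemma complex_ReM (z w : C) : Re (z * w) = Re z * Re w - Im z * Im w.
Proof. by case: z w => [a b] [c d]. Qed.

Lemma complex_ImM (z w : C) : Im (z * w) = Re z * Im w + Im z * Re w.
Proof. by case: z w => [a b] [c d]. Qed.

Lemma complex_ReD (z w : C) : Re (z + w) = Re z + Re w.
Proof. by case: z w => [a b] [c d]. Qed.

Lemma complex_ImD (z w : C) : Im (z + w) = Im z + Im w.
Proof. by case: z w => [a b] [c d]. Qed.

Lemma complex_ReN (z : C) : Re (- z) = - Re z. Proof. by case: z. Qed.

Lemma complex_ImN (z : C) : Im (- z) = - Im z. Proof. by case: z. Qed.

Definition complex_ReImE := (complex_ReM, complex_ImM, complex_ReD, complex_ImD,
  complex_ReN, complex_ImN).

Lemma complex_eqP (z w : C) : Re z = Re w -> Im z = Im w -> z = w.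
Proof. by case: z w => [a b] [c d] /= -> ->. Qed.

Lemma norm_complex_le (z : C) : `|z| <= (`|Re z| + `|Im z|)%:C.
Proof.
rewrite {1}(complexE z); apply: (le_trans (ler_normD _ _)).
rewrite normrM !normc_def /= expr0n /= addr0 add0r expr1n sqrtr1 mul1r.
by rewrite addr0 !sqrtr_sqr rmorphD.
Qed.

Lemma norm_Re_le (z : C) : (`|Re z|)%:C <= `|z|.
Proof. by rewrite normc_def lecR -sqrtr_sqr ler_wsqrtr// lerDl sqr_ge0. Qed.

Lemma norm_Im_le (z : C) : (`|Im z|)%:C <= `|z|.
Proof. by rewrite normc_def lecR -sqrtr_sqr ler_wsqrtr// lerDr sqr_ge0. Qed.

Definition cintegrable A f :=
  mu.-integrable A (EFin \o (fun x => Re (f x))) /\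
  mu.-integrable A (EFin \o (fun x => Im (f x))).

Lemma eq_Cintegral A f g : {in A, f =1 g} -> Cintegral A f = Cintegral A g.
Proof.
by move=> fg; congr (_ +i* _); apply: eq_Rintegral => x xA; rewrite fg.
Qed.

Lemma cintegrableZ A k f : measurable A -> cintegrable A f ->
  cintegrable A (fun x => k * f x).
Proof.
move=> mA [fr fi]; split.
- apply: (integrable_congr mA (f := fun x => Re k * Re (f x) + - Im k * Im (f x))).
    by move=> x _; rewrite complex_ReM mulNr.
  by apply: integrable_plus => //; exact: integrable_scale.
- apply: (integrable_congr mA (f := fun x => Re k * Im (f x) + Im k * Re (f x))).
    by move=> x _; rewrite complex_ImM.
  by apply: integrable_plus => //; exact: integrable_scale.
Qed.

Lemma CintegralD A f g : measurable A -> cintegrable A f -> cintegrable A g ->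
  Cintegral A (fun x => f x + g x) = Cintegral A f + Cintegral A g.
Proof.
move=> mA [fr fi] [gr gi]; apply: complex_eqP; rewrite !complex_ReImE /=.
- by rewrite -RintegralD//; apply: eq_Rintegral => x _; rewrite complex_ReD.
- by rewrite -RintegralD//; apply: eq_Rintegral => x _; rewrite complex_ImD.
Qed.

Lemma CintegralZ A k f : measurable A -> cintegrable A f ->
  Cintegral A (fun x => k * f x) = k * Cintegral A f.
Proof.
move=> mA [fr fi]; apply: complex_eqP; rewrite !complex_ReImE /=.
- rewrite -!RintegralZl// -RintegralB//; try exact: integrable_scale.
  by apply: eq_Rintegral => x _; rewrite complex_ReM.
- rewrite -!RintegralZl// -RintegralD//; try exact: integrable_scale.
  by apply: eq_Rintegral => x _; rewrite complex_ImM.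
Qed.

Lemma cintegrable_subitv f x y : x <= y ->
  cintegrable `[0, y] f -> cintegrable `[0, x] f.
Proof. by move=> xy [fr fi]; split; exact: integrable_subitv xy _. Qed.

Definition cdensity (l : R) f df : Prop :=
  has_density l (fun x => Re (f x)) (fun x => Re (df x)) /\
  has_density l (fun x => Im (f x)) (fun x => Im (df x)).

Lemma cdensityP l f df : cdensity l f df <-> cintegrable `[0, l] df /\
  forall x, x \in `[0, l] -> f x = f 0 + Cintegral `[0, x] df.
Proof.
split=> [[[ir rE] [ii iE]]|[[ir ii] fE]].
  split=> // x xl; apply: complex_eqP; rewrite complex_ReImE /=.
  - by rewrite rE.
  - by rewrite iE.
by split; split=> // x xl; rewrite {1}fE// complex_ReImE.
Qed.

Lemma has_density_congr l (f g df dg : R -> R) : f =1 g -> df =1 dg ->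
  has_density l f df -> has_density l g dg.
Proof. by move=> /funext-> /funext->. Qed.

Lemma cdensityD l f df g dg : cdensity l f df -> cdensity l g dg ->
  cdensity l (fun x => f x + g x) (fun x => df x + dg x).
Proof.
move=> [fr fi] [gr gi]; split.
- apply: has_density_congr (has_densityD fr gr) => x; by rewrite complex_ReImE.
- apply: has_density_congr (has_densityD fi gi) => x; by rewrite complex_ReImE.
Qed.

Lemma cdensityM l f df g dg : cdensity l f df -> cdensity l g dg ->
  cdensity l (fun x => f x * g x) (fun x => df x * g x + f x * dg x).
Proof.
move=> [fr fi] [gr gi]; split.
- apply: has_density_congr (has_densityD (has_densityM fr gr)
    (has_densityZ (-1) (has_densityM fi gi))) => x;
    by rewrite !complex_ReImE; ring.
- apply: has_density_congr (has_densityD (has_densityM fr gi)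
    (has_densityM fi gr)) => x; by rewrite !complex_ReImE; ring.
Qed.

Lemma cdensityZ l k f df : cdensity l f df ->
  cdensity l (fun x => k * f x) (fun x => k * df x).
Proof.
move=> [fr fi]; split.
- apply: has_density_congr (has_densityD (has_densityZ (Re k) fr)
    (has_densityZ (- Im k) fi)) => x; by rewrite !complex_ReImE; ring.
- apply: has_density_congr (has_densityD (has_densityZ (Re k) fi)
    (has_densityZ (Im k) fr)) => x; by rewrite !complex_ReImE; ring.
Qed.

Lemma Rintegral_ae_eq A (f g : R -> R) : measurable A ->
  mu.-integrable A (EFin \o f) -> mu.-integrable A (EFin \o g) ->
  {ae mu, forall x, A x -> f x = g x} ->
  \int[mu]_(x in A) f x = \int[mu]_(x in A) g x.
Proof.
move=> mA /(measurable_int mu) mf /(measurable_int mu) mg fg.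
have fg' : {ae mu, forall x, A x -> (f x)%:E = (g x)%:E}.
  by apply: ae_imply fg => x + Ax => ->.
by congr fine; apply: ae_eq_integral.
Qed.

Lemma has_density_ae l (f df dg : R -> R) : mu.-integrable `[0, l] (EFin \o dg) ->
  {ae mu, forall x, `[0, l]%classic x -> df x = dg x} ->
  has_density l f df -> has_density l f dg.
Proof.
move=> ig dfg [idf fE]; split=> // x xl; rewrite fE//; congr (_ + _).
move: xl; rewrite in_itv/= => /andP[_ xl].
apply: Rintegral_ae_eq => //; try exact: integrable_subitv xl _.
apply: ae_imply dfg => t /= + tx; apply; move: tx; rewrite !in_itv/=.
by case/andP => -> /le_trans; apply.
Qed.

(** The differential equation, which holds almost everywhere, is used through
this lemma. *)
Lemma cdensity_ae l f df dg : cintegrable `[0, l] dg ->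
  {ae mu, forall x, `[0, l]%classic x -> df x = dg x} ->
  cdensity l f df -> cdensity l f dg.
Proof.
move=> [igr igi] dfg [fr fi]; split.
- by apply: has_density_ae fr => //; apply: ae_imply dfg => x + xl => ->.
- by apply: has_density_ae fi => //; apply: ae_imply dfg => x + xl => ->.
Qed.

(** The functions on [0, l] on which the operators below act; they are an
algebra that contains the absolutely continuous functions. In lemma names it is
abbreviated bm. *)
Definition bounded_measurable (l : R) f : Prop :=
  [/\ measurable_fun `[0, l] (fun x => Re (f x)),
      measurable_fun `[0, l] (fun x => Im (f x))
    & exists M : R, forall x, x \in `[0, l] -> `|f x| <= M%:C].

Lemma has_density_measurable l (f df : R -> R) : 0 <= l -> has_density l f df ->
  measurable_fun `[0, l] f.
Proof.
move=> l0 [idf fE].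
have mF : measurable_fun `[0, l] (fun x : R => f 0 + \int[mu]_(t in `[0, x]) df t).
  apply: measurable_funD => //; apply: subspace_continuous_measurable_fun => //.
  exact: parameterized_integral_continuous.
by apply: eq_measurable_fun mF => x; rewrite mem_setE => xl; rewrite -fE.
Qed.

Lemma cdensity_bm l f df : 0 <= l -> cdensity l f df -> bounded_measurable l f.
Proof.
move=> l0 [fr fi]; split; try exact: has_density_measurable fr;
  try exact: has_density_measurable fi.
have [M1 h1] := has_density_bounded fr; have [M2 h2] := has_density_bounded fi.
exists (M1 + M2) => x xl; apply: le_trans (norm_complex_le _) _.
by rewrite lecR lerD ?h1 ?h2.
Qed.

Lemma bm_bound l f : bounded_measurable l f ->
  exists M : R, 0 <= M /\ forall x, x \in `[0, l] -> `|f x| <= M%:C.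
Proof.
move=> [_ _ [M fM]]; exists `|M|; split=> // x xl.
by apply: le_trans (fM x xl) _; rewrite lecR ler_norm.
Qed.

Lemma bmM l f g : bounded_measurable l f -> bounded_measurable l g ->
  bounded_measurable l (fun x => f x * g x).
Proof.
move=> bf bg; have [M [M0 fM]] := bm_bound bf; have [N [N0 gN]] := bm_bound bg.
case: bf bg => [fr fi _] [gr gi _]; split.
- apply: eq_measurable_fun (measurable_funB (measurable_funM fr gr)
    (measurable_funM fi gi)) => x _ /=; by rewrite complex_ReM.
- apply: eq_measurable_fun (measurable_funD (measurable_funM fr gi)
    (measurable_funM fi gr)) => x _ /=; by rewrite complex_ImM.
- exists (M * N) => x xl; rewrite normrM rmorphM ler_pM ?normr_ge0 ?fM ?gN//.
Qed.

Lemma bmZ l k f : bounded_measurable l f -> bounded_measurable l (fun x => k * f x).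
Proof.
move=> bf; apply: bmM bf; split=> //=; exists (`|Re k| + `|Im k|) => x _.
exact: norm_complex_le.
Qed.

Lemma bmD l f g : bounded_measurable l f -> bounded_measurable l g ->
  bounded_measurable l (fun x => f x + g x).
Proof.
case=> [fr fi [M fM]] [gr gi [N gN]]; split.
- by apply: eq_measurable_fun (measurable_funD fr gr) => x _ /=; rewrite complex_ReD.
- by apply: eq_measurable_fun (measurable_funD fi gi) => x _ /=; rewrite complex_ImD.
- exists (M + N) => x xl; apply: le_trans (ler_normD _ _) _.
  by rewrite rmorphD lerD ?fM ?gN.
Qed.

Lemma mu_itv_lty (x : R) : (mu `[0%R, x]%classic < +oo)%E.
Proof. by rewrite lebesgue_measure_itv; case: ifP; rewrite ltry. Qed.

Lemma bm_integrable l f : bounded_measurable l f -> cintegrable `[0, l] f.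
Proof.
case=> [fr fi [M fM]].
have fin := mu_itv_lty l.
split; apply: measurable_bounded_integrable => //.
- exists M; split; first exact: num_real.
  move=> y My x /= xl; rewrite (le_trans _ (ltW My))// -lecR.
  exact: le_trans (norm_Re_le _) (fM _ _).
- exists M; split; first exact: num_real.
  move=> y My x /= xl; rewrite (le_trans _ (ltW My))// -lecR.
  exact: le_trans (norm_Im_le _) (fM _ _).
Qed.

Lemma Rintegral_le_bound (x l : R) (f : R -> R) (M : R) :
  x \in `[0, l] -> mu.-integrable `[0, l] (EFin \o f) ->
  (forall t, t \in `[0, l] -> `|f t| <= M) ->
  `|\int[mu]_(t in `[0, x]) f t| <= l * M.
Proof.
rewrite in_itv/= => /andP[x0 xl] fi fM.
have fix_ := integrable_subitv xl fi.
have M0 : 0 <= M.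
  by rewrite (le_trans _ (fM 0 _))// in_itv/= lexx (le_trans x0 xl).
apply: le_trans (le_normr_Rintegral _ fix_) _ => //.
apply: (@le_trans _ _ (\int[mu]_(t in `[0, x]) M)).
  apply: le_Rintegral => //; first exact: integrable_norm.
    apply: measurable_bounded_integrable => //; last exact: bounded_cst.
    exact: mu_itv_lty.
  move=> t /=; rewrite in_itv/= => /andP[t0 tx]; apply: fM.
  by rewrite in_itv/= t0 (le_trans tx).
have muE : mu `[0%R, x]%classic = x%:E.
  rewrite lebesgue_measure_itv /= lte_fin; case: ifP => [_|].
    by rewrite sube0.
  by move/negbT; rewrite -leNgt => xle0; congr (_%:E); apply/le_anti; rewrite x0.
have E : \int[mu]_(t in `[0, x]) M = M * fine (mu `[0%R, x]%classic).
  exact: Rintegral_cst.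
by rewrite E muE /= mulrC ler_wpM2r.
Qed.

Lemma Cintegral_bound x l f M : x \in `[0, l] -> bounded_measurable l f ->
  (forall t, t \in `[0, l] -> `|f t| <= M%:C) ->
  `|Cintegral `[0, x] f| <= (2 * l * M)%:C.
Proof.
move=> xl /bm_integrable[fr fi] fM; apply: le_trans (norm_complex_le _) _.
rewrite lecR (_ : 2 * l * M = l * M + l * M); last by ring.
apply: lerD; apply: Rintegral_le_bound => // t tl; rewrite -lecR.
- exact: le_trans (norm_Re_le _) (fM _ tl).
- exact: le_trans (norm_Im_le _) (fM _ tl).
Qed.

End ComplexIntegral.

(** * The equation on one edge: Wronskians and variation of constants *)

Section Schrodinger.
Variables (R : realType) (l : R) (q : R -> R).
Hypothesis l_ge0 : 0 <= l.
Local Notation mu := (@lebesgue_measure R).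
Local Notation C := R[i].
Local Notation Re := complex.Re.
Local Notation Im := complex.Im.
Implicit Types (y dy z dz c dc s ds f g : R -> C) (lam nu : C).

(** On a bounded interval |f| <= 1 + f^2. *)
Lemma L2_real_integrable (m : R) (f : R -> R) :
  L2_real `[0, m] f -> mu.-integrable `[0, m] (EFin \o f).
Proof.
move=> [mf if2].
have i1 : mu.-integrable `[0, m] (EFin \o cst (1 : R)).
  by apply: measurable_bounded_integrable => //;
    [exact: mu_itv_lty|exact: bounded_cst].
apply: le_integrable (integrable_plus _ i1 if2) => //; first exact/measurable_EFinP.
move=> x _ /=; rewrite lee_fin ler_norml; apply/andP.
have f2 : 0 <= 1 + f x ^+ 2 by rewrite addr_ge0 ?sqr_ge0.
by rewrite ger0_norm//; split; nra.
Qed.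

Lemma L2_complex_integrable (m : R) f :
  L2_complex `[0, m] f -> cintegrable `[0, m] f.
Proof. by case=> fr fi; split; exact: L2_real_integrable. Qed.

Lemma H2_density (m : R) y dy ddy : H2 `[0, m] y dy ddy ->
  cdensity m y dy /\ cdensity m dy ddy.
Proof.
by case=> _ dyL2 ddyL2 yE dyE; split; apply/cdensityP; split=> //;
  exact: L2_complex_integrable.
Qed.

Lemma schrodinger_density lam y dy : schrodinger_solution l q lam y dy ->
  exists ddy, [/\ cdensity l y dy, cdensity l dy ddy
    & {ae mu, forall x, `[0, l]%classic x -> ddy x = ((q x)%:C - lam) * y x}].
Proof.
move=> [ddy [/H2_density[yd dyd] eq]]; exists ddy; split=> //.
by apply: ae_imply eq => x + xl => /(_ xl) E; rewrite mulrBl -E; ring.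
Qed.

Lemma solution_bm lam y dy : schrodinger_solution l q lam y dy ->
  bounded_measurable l y.
Proof. by case/schrodinger_density => ddy [yd _ _]; exact: cdensity_bm yd. Qed.

(** (y z' - y' z)' = y z'' - y'' z, where q cancels. *)
Lemma wronskian_density lam nu y dy z dz :
  schrodinger_solution l q lam y dy -> schrodinger_solution l q nu z dz ->
  cdensity l (fun x => y x * dz x - dy x * z x)
             (fun x => (lam - nu) * (y x * z x)).
Proof.
move=> ys zs; have by_ := solution_bm ys; have bz := solution_bm zs.
have [ddy [yd dyd yE]] := schrodinger_density ys.
have [ddz [zd dzd zE]] := schrodinger_density zs.
have D := cdensityD (cdensityM yd dzd) (cdensityZ (-1) (cdensityM dyd zd)).
have D' : cdensity l (fun x => y x * dz x - dy x * z x) (fun x =>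
    dy x * dz x + y x * ddz x + -1 * (ddy x * z x + dy x * dz x)).
  by congr cdensity : D; apply/funext => x; rewrite mulN1r.
apply: cdensity_ae D'.
  exact: bm_integrable (bmZ _ (bmM by_ bz)).
by apply: ae_imply2 yE zE => x E1 E2 xl; rewrite E1// E2//; ring.
Qed.

Lemma wronskianE lam nu y dy z dz x :
  schrodinger_solution l q lam y dy -> schrodinger_solution l q nu z dz ->
  x \in `[0, l] ->
  y x * dz x - dy x * z x = y 0 * dz 0 - dy 0 * z 0 +
    (lam - nu) * Cintegral `[0, x] (fun t => y t * z t).
Proof.
move=> ys zs xl; have [_ /(_ x xl) ->] := (cdensityP _ _ _).1 (wronskian_density ys zs).
rewrite CintegralZ//.
move: xl; rewrite in_itv/= => /andP[_ xl]; apply: cintegrable_subitv xl _.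
by apply: bm_integrable; apply: bmM; [exact: solution_bm ys|exact: solution_bm zs].
Qed.

(** The solution with zero initial data of - u'' + q u - nu u = f, by variation of
constants. *)
Definition duhamel c s f (x : R) : C :=
  c x * Cintegral `[0, x] (fun t => f t * s t) -
  s x * Cintegral `[0, x] (fun t => f t * c t).

(** The derivative of [duhamel c s f]. *)
Definition duhamel' c s dc ds f (x : R) : C :=
  dc x * Cintegral `[0, x] (fun t => f t * s t) -
  ds x * Cintegral `[0, x] (fun t => f t * c t).

Section Fundamental.
Variables (nu : C) (c dc s ds : R -> C).
Hypothesis fs : fundamental_system l q nu c dc s ds.

Lemma fundamental_wronskian x : x \in `[0, l] -> c x * ds x - dc x * s x = 1.
Proof.
case: fs => -[cs c0 dc0] [ss s0 ds0] xl.
by rewrite (wronskianE cs ss xl) c0 dc0 s0 ds0 subrr !mul0r; ring.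
Qed.

(** Since c s' - c' s = 1, y is the combination of c and s with coefficients y
s' - y' s and c y' - c' y, and the Wronskian identity evaluates both. At lam =
nu this says that c and s span the solutions. *)
Lemma solution_duhamel lam y dy x : schrodinger_solution l q lam y dy ->
  x \in `[0, l] ->
  y x = y 0 * c x + dy 0 * s x + (lam - nu) * duhamel c s y x /\
  dy x = y 0 * dc x + dy 0 * ds x + (lam - nu) * duhamel' c s dc ds y x.
Proof.
case: (fs) => -[cs c0 dc0] [ss s0 ds0] ys xl.
have W := fundamental_wronskian xl.
have := wronskianE ys ss xl; have := wronskianE ys cs xl.
rewrite /duhamel /duhamel' c0 dc0 s0 ds0 !(mulr0, mulr1, subr0, sub0r).
set Ic := Cintegral _ _; set Is := Cintegral _ _ => Ec Es.
split.
- have -> : y x = c x * (y x * ds x - dy x * s x) - s x * (y x * dc x - dy x * c x).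
    by rewrite -[LHS]mulr1 -W; ring.
  by rewrite Ec Es; ring.
- have -> : dy x = dc x * (y x * ds x - dy x * s x) - ds x * (y x * dc x - dy x * c x).
    by rewrite -[LHS]mulr1 -W; ring.
  by rewrite Ec Es; ring.
Qed.

Lemma solution_fundamental y dy x : schrodinger_solution l q nu y dy ->
  x \in `[0, l] ->
  y x = y 0 * c x + dy 0 * s x /\ dy x = y 0 * dc x + dy 0 * ds x.
Proof.
by move=> ys xl; have [-> ->] := solution_duhamel ys xl; rewrite subrr !mul0r !addr0.
Qed.

Lemma duhamel_bm f : bounded_measurable l f -> bounded_measurable l (duhamel c s f).
Proof.
case: fs => -[cs _ _] [ss _ _] bf.
have bc := solution_bm cs; have bs := solution_bm ss.
have bI g : bounded_measurable l g ->
    bounded_measurable l (fun x => Cintegral `[0, x] g).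
  move=> /bm_integrable ig; apply: (@cdensity_bm _ _ _ g) => //.
  apply/cdensityP; split=> // x xl; rewrite -[LHS]add0r; congr (_ + _).
  by rewrite set_itv1 /Cintegral !Rintegral_set1.
have -> : duhamel c s f = fun x => c x * Cintegral `[0, x] (fun t => f t * s t) +
    -1 * (s x * Cintegral `[0, x] (fun t => f t * c t)).
  by apply/funext => x; rewrite mulN1r.
apply: bmD; [apply: bmM => //|apply: bmZ; apply: bmM => //]; apply: bI; exact: bmM.
Qed.

(** Continuous linear forms for the supremum norm, on bounded measurable functions. *)
Definition bounded_functional (L : (R -> C) -> C) : Prop :=
  (forall f g k, bounded_measurable l f -> bounded_measurable l g ->
     L (fun x => f x + k * g x) = L f + k * L g) /\
  exists K : R, 0 <= K /\ forall f (M : R), bounded_measurable l f ->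
     (forall x, x \in `[0, l] -> `|f x| <= M%:C) -> `|L f| <= (K * M)%:C.

Lemma Cintegral_mul_functional g x : bounded_measurable l g -> x \in `[0, l] ->
  bounded_functional (fun f => Cintegral `[0, x] (fun t => f t * g t)).
Proof.
move=> bg xl; split.
  move=> f h k bf bh; have xl' : x <= l by move: xl; rewrite in_itv/= => /andP[].
  have i1 := cintegrable_subitv xl' (bm_integrable (bmM bf bg)).
  have i2 := cintegrable_subitv xl' (bm_integrable (bmM bh bg)).
  rewrite -CintegralZ// -CintegralD//; last exact: cintegrableZ.
  by apply: eq_Cintegral => t _; ring.
have [N [N0 gN]] := bm_bound bg.
exists (2 * l * N); split; first by rewrite !mulr_ge0.
move=> f M bf fM; rewrite -mulrA; apply: Cintegral_bound => //; first exact: bmM.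
move=> t tl; rewrite normrM mulrC rmorphM ler_pM ?normr_ge0 ?gN ?fM//.
Qed.

Lemma bounded_functionalB a b L1 L2 : bounded_functional L1 -> bounded_functional L2 ->
  bounded_functional (fun f => a * L1 f - b * L2 f).
Proof.
move=> [l1 [K1 [K10 b1]]] [l2 [K2 [K20 b2]]]; split.
  by move=> f g k bf bg; rewrite l1// l2//; ring.
have normcC (z : C) : `|z| = (Re `|z|)%:C by rewrite RRe_real// normr_real.
have nn (z : C) : 0 <= Re `|z| by rewrite -ler0c -normcC.
exists (Re `|a| * K1 + Re `|b| * K2); split.
  by rewrite addr_ge0// mulr_ge0.
move=> f M bf fM; apply: le_trans (ler_normB _ _) _.
rewrite !normrM mulrDl rmorphD -!mulrA !(rmorphM _ (Re _)) /= -!normcC.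
by apply: lerD; apply: ler_wpM2l => //; [exact: b1|exact: b2].
Qed.

Lemma duhamel_functional x : x \in `[0, l] ->
  bounded_functional (duhamel c s ^~ x).
Proof.
case: fs => -[cs _ _] [ss _ _] xl.
by apply: bounded_functionalB; apply: Cintegral_mul_functional => //;
  [exact: solution_bm ss|exact: solution_bm cs].
Qed.

Lemma duhamel'_functional x : x \in `[0, l] ->
  bounded_functional (duhamel' c s dc ds ^~ x).
Proof.
case: fs => -[cs _ _] [ss _ _] xl.
by apply: bounded_functionalB; apply: Cintegral_mul_functional => //;
  [exact: solution_bm ss|exact: solution_bm cs].
Qed.

(** Unlike in [duhamel_functional], the bound K does not depend on x, so that
[duhamel] can be iterated. *)
Lemma duhamel_bounded : exists K : R, 0 <= K /\ forall f (M : R),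
  bounded_measurable l f -> (forall x, x \in `[0, l] -> `|f x| <= M%:C) ->
  forall x, x \in `[0, l] -> `|duhamel c s f x| <= (K * M)%:C.
Proof.
case: fs => -[cs _ _] [ss _ _].
have bc := solution_bm cs; have bs := solution_bm ss.
have [N1 [N10 cN]] := bm_bound bc; have [N2 [N20 sN]] := bm_bound bs.
exists (4 * l * N1 * N2); split; first by rewrite !mulr_ge0.
move=> f M bf fM x xl; apply: le_trans (ler_normB _ _) _.
have -> : 4 * l * N1 * N2 * M = N1 * (2 * l * (M * N2)) + N2 * (2 * l * (M * N1)).
  by ring.
have b g N : bounded_measurable l g -> 0 <= N ->
   (forall x, x \in `[0, l] -> `|g x| <= N%:C) ->
   `|Cintegral `[0, x] (fun t => f t * g t)| <= (2 * l * (M * N))%:C.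
  move=> bg N0 gN; apply: Cintegral_bound => //; first exact: bmM.
  by move=> t tl; rewrite normrM rmorphM ler_pM ?normr_ge0 ?gN ?fM.
rewrite rmorphD !(rmorphM _ N1) !(rmorphM _ N2) !normrM.
by apply: lerD; apply: ler_pM; rewrite ?normr_ge0 ?cN ?sN ?b.
Qed.

End Fundamental.
End Schrodinger.

(** * Complex differentiability *)

Section Slopes.
Variable K : numFieldType.
Implicit Types (f g : K -> K) (z w : K).

(** Complex differentiability in Caratheodory's form, with a slope g continuous
at z. Sums, products and composites of such functions are then plain algebra on
slopes. *)
Definition cdiff f z : Prop :=
  exists2 g : K -> K, {for z, continuous g} & forall w, f w = f z + (w - z) * g w.

Lemma lipschitz_at_continuous g z (k e : K) : 0 < e ->
  (forall w, `|w - z| < e -> `|g w - g z| <= k * `|w - z|) ->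
  {for z, continuous g}.
Proof.
move=> e0 gk.
have k0 : 0 <= k.
  have h : `|(z + e / 2) - z| = e / 2 by rewrite addrC addKr ger0_norm// divr_ge0// ltW.
  have := gk (z + e / 2); rewrite h => /(_ _)/(le_trans (normr_ge0 _)) H.
  by move: H; rewrite pmulr_lge0 ?divr_gt0//; apply; rewrite gtr_pMr ?invf_lt1 ?ltr1n.
apply/(@cvgrPdist_lt K K K (nbhs z) (nbhs_filter z)) => r r0; near=> w.
rewrite distrC; apply: le_lt_trans (gk w _) _.
  by rewrite distrC; near: w; exact: cvgr_dist_lt.
have wk : `|w - z| < r / (k + 1).
  rewrite distrC; near: w; apply: cvgr_dist_lt; first exact: cvg_id.
  by rewrite divr_gt0// ltr_wpDl.
apply: (@le_lt_trans _ _ ((k + 1) * `|w - z|)).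
  by rewrite ler_wpM2r// lerDl ler01.
by rewrite mulrC -ltr_pdivlMr// ltr_wpDl.
Unshelve. all: by end_near. Qed.

Lemma cdiff_continuous f z : cdiff f z -> {for z, continuous f}.
Proof.
case=> g gz fE; have -> : f = fun w => f z + (w - z) * g w by apply/funext.
apply: continuousD; first exact: cst_continuous.
apply: continuousM => //; apply: continuousB; first exact: cvg_id.
exact: cst_continuous.
Qed.

Lemma cdiff_cst k z : cdiff (fun=> k) z.
Proof. by exists (fun=> 0) => [|w]; [exact: cst_continuous|rewrite mulr0 addr0]. Qed.

Lemma cdiff_id z : cdiff id z.
Proof. by exists (fun=> 1) => [|w]; [exact: cst_continuous|rewrite mulr1; ring]. Qed.

Lemma cdiffD f g z : cdiff f z -> cdiff g z -> cdiff (fun w => f w + g w) z.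
Proof.
case=> f1 cf fE [g1 cg gE]; exists (fun w => f1 w + g1 w); first exact: continuousD.
by move=> w; rewrite {1}fE {1}gE; ring.
Qed.

Lemma cdiffM f g z : cdiff f z -> cdiff g z -> cdiff (fun w => f w * g w) z.
Proof.
move=> df dg; have cg := cdiff_continuous dg.
case: df dg => f1 cf fE [g1 cg1 gE].
exists (fun w => f1 w * g w + f z * g1 w).
  apply: continuousD; apply: continuousM => //; exact: cst_continuous.
by move=> w; rewrite {1}fE mulrDl {1}gE; ring.
Qed.

Lemma cdiff_comp f h z : cdiff h z -> cdiff f (h z) -> cdiff (fun w => f (h w)) z.
Proof.
move=> dh; have ch := cdiff_continuous dh; case: dh => h1 ch1 hE [f1 cf fE].
exists (fun w => h1 w * f1 (h w)).
  by apply: continuousM => //; apply: continuous_comp.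
move=> w; rewrite [LHS]fE (_ : h w - h z = (w - z) * h1 w); first by ring.
by rewrite {1}hE; ring.
Qed.

Lemma cdiff_sum (I : Type) (r : seq I) (P : pred I) (F : I -> K -> K) z :
  (forall i, P i -> cdiff (F i) z) -> cdiff (fun w => \sum_(i <- r | P i) F i w) z.
Proof.
move=> dF; elim: r => [|i r IH].
  by under eq_fun do rewrite big_nil; exact: cdiff_cst.
under eq_fun do rewrite big_cons; case: (boolP (P i)) => // Pi.
by apply: cdiffD => //; exact: dF.
Qed.

Lemma cdiff_prod (I : Type) (r : seq I) (P : pred I) (F : I -> K -> K) z :
  (forall i, P i -> cdiff (F i) z) -> cdiff (fun w => \prod_(i <- r | P i) F i w) z.
Proof.
move=> dF; elim: r => [|i r IH].
  by under eq_fun do rewrite big_nil; exact: cdiff_cst.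
under eq_fun do rewrite big_cons; case: (boolP (P i)) => // Pi.
by apply: cdiffM => //; exact: dF.
Qed.

Lemma cdiff_det n (A : K -> 'M[K]_n) z :
  (forall i j, cdiff (fun w => A w i j) z) -> cdiff (fun w => \det (A w)) z.
Proof.
move=> dA; apply: cdiff_sum => s _; apply: cdiffM; first exact: cdiff_cst.
by apply: cdiff_prod => i _.
Qed.

Lemma cdiff_derivable f z : cdiff f z -> derivable f z 1.
Proof.
case=> g cg fE; apply/cvg_ex; exists (g z).
have cg' : g (h + z) @[h --> 0^'] --> g z.
  apply: cvg_within_filter => //.
  have : {for 0, continuous (fun h => g (h + z))}.
    apply: continuous_comp; last by rewrite add0r.
    apply: continuousD; [exact: cvg_id|exact: cst_continuous].
  by rewrite /prop_for /continuous_at add0r.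
apply: cvg_trans cg'; apply: near_eq_cvg; near=> h.
have h0 : h != 0 by near: h; exact: nbhs_dnbhs_neq.
rewrite /= fE [h *: 1]mulr1 addrK addrAC subrr add0r.
by rewrite -[_ *: _]/(h^-1 * _) mulrA mulVf// mul1r.
Unshelve. all: by end_near. Qed.

End Slopes.

(** * Analytic dependence on the spectral parameter *)

Lemma bounded_functional_ext (R : realType) (l : R) (L : (R -> R[i]) -> R[i])
    (f g : R -> R[i]) :
  bounded_functional l L -> bounded_measurable l f -> bounded_measurable l g ->
  (forall x, x \in `[0, l] -> f x = g x) -> L f = L g.
Proof.
move=> [lin [k [k0 bL]]] bf bg fg.
apply/eqP; rewrite -subr_eq0 -normr_le0 -mulN1r -lin//.
have := bL (fun x => f x + -1 * g x) 0 (bmD bf (bmZ _ bg)); rewrite mulr0; apply.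
by move=> x xl; rewrite fg// mulN1r subrr normr0.
Qed.

Section SpectralDependence.
Variables (R : realType) (l : R) (q : R -> R).
Hypothesis l_ge0 : 0 <= l.
Local Notation C := R[i].
Local Notation Re := complex.Re.
Variables (nu : C) (c dc s ds : R -> C).
Hypothesis fs : fundamental_system l q nu c dc s ds.
Variables (Y dY : C -> R -> C) (y0 y1 : C).
Hypothesis Ysol : forall lam, schrodinger_solution l q lam (Y lam) (dY lam).
Hypothesis Y0 : forall lam, Y lam 0 = y0.
Hypothesis dY0 : forall lam, dY lam 0 = y1.

(** The initial data do not depend on lam, so the first terms of the variation
of constants formula are the solution at nu. *)
Lemma parameter_expansion lam x : x \in `[0, l] ->
  Y lam x = Y nu x + (lam - nu) * duhamel c s (Y lam) x /\
  dY lam x = dY nu x + (lam - nu) * duhamel' c s dc ds (Y lam) x.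
Proof.
move=> xl; have [-> ->] := solution_duhamel l_ge0 fs (Ysol lam) xl.
have [-> ->] := solution_fundamental l_ge0 fs (Ysol nu) xl.
by rewrite !Y0 !dY0.
Qed.

Lemma family_bm lam : bounded_measurable l (Y lam).
Proof. exact: solution_bm (Ysol lam). Qed.

(** For lam close to nu the expansion reads |Y_lam| <= |Y_nu| + |Y_lam| / 2 in
supremum norm, and Y_lam is bounded, so |Y_lam| <= 2 |Y_nu|. *)
Lemma locally_bounded : exists N d : R, [/\ 0 <= N, 0 < d &
  forall lam, `|lam - nu| < d%:C -> forall x, x \in `[0, l] -> `|Y lam x| <= N%:C].
Proof.
have [K [K0 bK]] := duhamel_bounded l_ge0 fs.
have [A [A0 bA]] := bm_bound (family_bm nu).
(* The radius gives |lam - nu| K <= 1 / 2. *)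
exists (2 * A), (2 * (K + 1))^-1; split; first by rewrite mulr_ge0.
  by rewrite invr_gt0 mulr_gt0// ltr_wpDl.
move=> lam lamnu x xl; pose S := [set Re `|Y lam x| | x in [set` `[0, l]]].
have normcC (z : C) : `|z| = (Re `|z|)%:C by rewrite RRe_real// normr_real.
have [B [B0 bB]] := bm_bound (family_bm lam).
have hS : has_sup S.
  split; first by exists (Re `|Y lam x|); exists x.
  by exists B => _ [t tl <-]; rewrite -lecR -normcC bB.
have supS t : t \in `[0, l] -> `|Y lam t| <= (sup S)%:C.
  by move=> tl; rewrite normcC lecR; apply: sup_upper_bound => //; exists t.
have supS0 : 0 <= sup S.
  by rewrite -ler0c; apply: le_trans (supS x xl); exact: normr_ge0.
have step t : t \in `[0, l] -> Re `|Y lam t| <= A + sup S / 2.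
  move=> tl; rewrite -lecR -normcC; have [-> _] := parameter_expansion lam tl.
  rewrite rmorphD; apply: le_trans (ler_normD _ _) _; apply: lerD; first exact: bA.
  rewrite normrM.
  apply: (@le_trans _ _ (((2 * (K + 1))^-1)%:C * (K * sup S)%:C)).
    apply: ler_pM; rewrite ?normr_ge0//; first exact: ltW.
    by apply: bK => //; exact: family_bm.
  rewrite -rmorphM lecR mulrA [leRHS]mulrC ler_wpM2r// mulrC.
  by rewrite ler_pdivrMr ?mulr_gt0 ?ltr_wpDl//; lra.
have : sup S <= A + sup S / 2.
  by apply: ge_sup hS.1 _ => _ [t tl <-]; exact: step.
move=> H; apply: le_trans (supS x xl) _; rewrite lecR; lra.
Qed.

(** The slope is L(K Y_lam) with K = duhamel c s. By the expansion once more,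
L(K Y_lam) - L(K Y_nu) = (lam - nu) L(K K Y_lam), which the local bound makes
Lipschitz at nu. *)
Lemma functional_cdiff L : bounded_functional l L -> cdiff (fun lam => L (Y lam)) nu.
Proof.
move=> [lin [k [k0 bL]]].
have bD f : bounded_measurable l f -> _ := duhamel_bm l_ge0 fs (f := f).
have lext f g :=
  bounded_functional_ext (conj lin (ex_intro _ k (conj k0 bL))) (f := f) (g := g).
exists (fun lam => L (duhamel c s (Y lam))); last first.
  move=> lam; rewrite -lin; [|exact: family_bm|exact/bD/family_bm].
  apply: lext; [exact: family_bm| |
    by move=> x xl; have [] := parameter_expansion lam xl].
  by apply: bmD; [|apply: bmZ; apply: bD]; exact: family_bm.
have [N [d [N0 d0 bN]]] := locally_bounded.
have [K [K0 bK]] := duhamel_bounded l_ge0 fs.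
apply: (@lipschitz_at_continuous _ _ _ (k * (K * (K * N)))%:C d%:C).
  by rewrite (ltcR 0).
move=> lam lamnu.
have -> : L (duhamel c s (Y lam)) - L (duhamel c s (Y nu)) =
    (lam - nu) * L (duhamel c s (duhamel c s (Y lam))).
  rewrite -(addrK (L (duhamel c s (Y nu))) (_ * _)); congr (_ - _); rewrite addrC.
  have b1 := bD _ (family_bm nu); have b2 := bD _ (bD _ (family_bm lam)).
  rewrite -lin//; apply: lext; [exact/bD/family_bm|exact: bmD b1 (bmZ _ b2)|].
  move=> x xl; have dF := duhamel_functional l_ge0 fs xl.
  rewrite -dF.1; [|exact: family_bm|exact/bD/family_bm].
  apply: (bounded_functional_ext dF); first exact: family_bm.
    by apply: bmD; [|apply: bmZ; apply: bD]; exact: family_bm.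
  by move=> t tl; have [] := parameter_expansion lam tl.
rewrite normrM mulrC ler_wpM2r//; apply: bL; first by apply/bD/bD/family_bm.
apply: (bK); first exact/bD/family_bm.
by apply: bK; [exact: family_bm|exact: bN].
Qed.

End SpectralDependence.

(** * Real coefficients and vanishing solutions *)

Section EdgeSolutions.
Variables (R : realType).
Local Notation mu := (@lebesgue_measure R).
Local Notation C := R[i].
Local Notation Re := complex.Re.
Local Notation Im := complex.Im.

Lemma L2_real_congr (A : set R) (f g : R -> R) : f =1 g -> L2_real A f -> L2_real A g.
Proof. by move=> /funext ->. Qed.

Lemma L2_realZ (A : set R) k (f : R -> R) : measurable A ->
  L2_real A f -> L2_real A (fun x => k * f x).
Proof.
move=> mA [mf if2]; split; first exact: measurable_funM.
apply: integrable_congr (integrable_scale (k ^+ 2) mA if2) => // x _.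
by rewrite exprMn.
Qed.

Lemma L2_realD (A : set R) (f g : R -> R) : measurable A ->
  L2_real A f -> L2_real A g -> L2_real A (fun x => f x + g x).
Proof.
move=> mA [mf if2] [mg ig2]; split; first exact: measurable_funD.
apply: le_integrable (integrable_plus mA (integrable_scale 2 mA if2)
  (integrable_scale 2 mA ig2)) => //.
  by apply/measurable_EFinP; apply: measurable_funX; exact: measurable_funD.
move=> x _ /=; rewrite lee_fin ger0_norm ?sqr_ge0// ger0_norm; last first.
  by apply: addr_ge0; apply: mulr_ge0 => //; exact: sqr_ge0.
by have := sqr_ge0 (f x - g x); nra.
Qed.

Lemma L2_complexZ (A : set R) k (f : R -> C) : measurable A ->
  L2_complex A f -> L2_complex A (fun x => k * f x).
Proof.
move=> mA [fr fi]; split.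
- apply: L2_real_congr (L2_realD mA (L2_realZ (Re k) mA fr)
    (L2_realZ (- Im k) mA fi)) => x; by rewrite complex_ReM mulNr.
- apply: L2_real_congr (L2_realD mA (L2_realZ (Re k) mA fi)
    (L2_realZ (Im k) mA fr)) => x; by rewrite complex_ImM.
Qed.

Lemma L2_complexD (A : set R) (f g : R -> C) : measurable A ->
  L2_complex A f -> L2_complex A g -> L2_complex A (fun x => f x + g x).
Proof.
move=> mA [fr fi] [gr gi]; split.
- by apply: L2_real_congr (L2_realD mA fr gr) => x; rewrite complex_ReD.
- by apply: L2_real_congr (L2_realD mA fi gi) => x; rewrite complex_ImD.
Qed.

Lemma L2_complex_conj (A : set R) (f : R -> C) : measurable A ->
  L2_complex A f -> L2_complex A (fun x => (f x)^*).
Proof.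
move=> mA [fr fi]; split.
- by apply: L2_real_congr fr => x; case: (f x).
- apply: L2_real_congr (L2_realZ (-1) mA fi) => x.
  by case: (f x) => a b /=; rewrite mulN1r.
Qed.

Lemma Cintegral_conj (A : set R) (f : R -> C) : measurable A -> cintegrable A f ->
  Cintegral A (fun x => (f x)^*) = (Cintegral A f)^*.
Proof.
move=> mA [fr fi]; apply: complex_eqP => /=.
  by apply: eq_Rintegral => x _; case: (f x).
rewrite -[RHS]mulN1r -RintegralZl//; apply: eq_Rintegral => x _.
by case: (f x) => a b /=; rewrite mulN1r.
Qed.

Lemma solution_combination (l : R) q lam y dy z dz (a b : C) :
  schrodinger_solution l q lam y dy -> schrodinger_solution l q lam z dz ->
  schrodinger_solution l q lam (fun x => a * y x + b * z x)
                               (fun x => a * dy x + b * dz x).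
Proof.
move=> [ddy [Hy yE]] [ddz [Hz zE]]; exists (fun x => a * ddy x + b * ddz x).
have [[y0 y1] [z0 z1]] := (H2_density Hy, H2_density Hz).
have [_ E0] := (cdensityP _ _ _).1 (cdensityD (cdensityZ a y0) (cdensityZ b z0)).
have [_ E1] := (cdensityP _ _ _).1 (cdensityD (cdensityZ a y1) (cdensityZ b z1)).
split.
  case: Hy Hz => ? ? ? _ _ [? ? ? _ _]; split; [| | |exact: E0|exact: E1];
    by apply: L2_complexD => //; exact: L2_complexZ.
apply: ae_imply2 yE zE => x + + xl => /(_ xl) yE /(_ xl) zE.
have -> : lam * (a * y x + b * z x) = a * (lam * y x) + b * (lam * z x) by ring.
by rewrite -yE -zE; ring.
Qed.

(** The potential is real, and so is lam. *)
Lemma solution_conj (l : R) q (lam : R) y dy : schrodinger_solution l q lam%:C y dy ->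
  schrodinger_solution l q lam%:C (fun x => (y x)^*) (fun x => (dy x)^*).
Proof.
move=> [ddy [Hy yE]]; exists (fun x => (ddy x)^*).
have conjE (f df : R -> C) : cintegrable `[0, l] df ->
    (forall x, `[0, l]%classic x -> f x = f 0 + Cintegral `[0, x] df) ->
    forall x, `[0, l]%classic x ->
      (f x)^* = (f 0)^* + Cintegral `[0, x] (fun t => (df t)^*).
  move=> idf fE x xl; rewrite {1}fE// rmorphD /= Cintegral_conj//.
  by apply: cintegrable_subitv idf; move: xl; rewrite /= in_itv/= => /andP[].
split.
  case: Hy => yL dyL ddyL y0 y1; split; try exact: L2_complex_conj;
    by apply: conjE => //; exact: L2_complex_integrable.
apply: ae_imply yE => x + xl => /(_ xl) /(congr1 (@conjc R)).
by rewrite rmorphD rmorphN !rmorphM /= !oppr0.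
Qed.

Lemma ae_itv_exists (l : R) (P : R -> Prop) : 0 < l ->
  {ae mu, forall x, `[0, l]%classic x -> P x} -> exists2 x, x \in `[0, l] & P x.
Proof.
move=> l0 aeP; apply: contrapT => nP.
have : mu.-negligible `[0%R, l]%classic.
  apply: negligibleS aeP => x xl /= /(_ xl) Px; apply: nP; by exists x.
move=> neg; have : mu `[0%R, l]%classic = 0%E by exact: measure_negligible neg.
rewrite lebesgue_measure_itv /= lte_fin l0 -EFinD subr0 => -[l0'].
by rewrite l0' ltxx in l0.
Qed.

(** The density 2 y y' of y^2 vanishes almost everywhere, so y^2 is constant, hence
zero; then y'' = 0 almost everywhere, so y' is constant, and it is zero because its
integral over [0, l] is. *)
Lemma solution_ae0 (l : R) q lam y dy : 0 < l -> schrodinger_solution l q lam y dy ->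
  {ae mu, forall x, `[0, l]%classic x -> y x = 0} -> y 0 = 0 /\ dy 0 = 0.
Proof.
move=> l0 ys yae; have [ddy [yd dyd yE]] := schrodinger_density ys.
have ll : l \in `[0, l] by rewrite in_itv/= lexx ltW.
have i0 : cintegrable `[0, l] (fun=> (0 : C)).
  by apply: bm_integrable; split=> //=; exists 0 => x _; rewrite normr0.
have int0 x : Cintegral `[0, x] (fun=> (0 : C)) = 0.
  by congr (_ +i* _) => /=; rewrite /Rintegral; under eq_integral do rewrite /=;
    rewrite integral0.
have const f df : cdensity l f df ->
    {ae mu, forall x, `[0, l]%classic x -> df x = 0} ->
    forall x, x \in `[0, l] -> f x = f 0.
  move=> fd /(cdensity_ae i0)/(_ fd)/cdensityP[_ fE] x xl.
  by rewrite fE// int0 addr0.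
have y2 x : x \in `[0, l] -> y x * y x = y 0 * y 0.
  apply: const (cdensityM yd yd) _ _; apply: ae_imply yae => t + tl => /(_ tl) ->.
  by rewrite mulr0 mul0r addr0.
have [x0 x0l yx0] := ae_itv_exists l0 yae.
have y0 x : x \in `[0, l] -> y x = 0.
  move=> xl; apply/eqP; rewrite -[_ == 0]orbb -mulf_eq0.
  by rewrite (y2 x xl) -(y2 _ x0l) yx0 mulr0.
have dy0 : forall x, x \in `[0, l] -> dy x = dy 0.
  apply: const dyd _; apply: ae_imply2 yE yae => t + + tl => /(_ tl) -> /(_ tl) ->.
  by rewrite mulr0.
have y00 : y 0 = 0 by apply: y0; rewrite in_itv/= lexx ltW.
split=> //; have [_ /(_ _ ll)] := (cdensityP _ _ _).1 yd.
rewrite y0// y00 add0r (eq_Cintegral (g := fun=> dy 0 * 1)); last first.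
  by move=> x; rewrite mem_setE => xl; rewrite dy0// mulr1.
have i1 : cintegrable `[0, l] (fun=> (1 : C)).
  by apply: bm_integrable; split=> //=; exists 1 => x _; rewrite normr1.
rewrite CintegralZ// => /esym/eqP; rewrite mulf_eq0 => /orP[/eqP//|].
rewrite /Cintegral eq_complex /= => /andP[].
have -> : \int[mu]_(x in `[0, l]) (1 : R) = 1 * fine (mu `[0%R, l]%classic).
  exact: Rintegral_cst.
rewrite lebesgue_measure_itv /= lte_fin l0 -EFinD /= subr0 mul1r.
by rewrite gt_eqF.
Qed.

Lemma mul_conjc_re (z : C) : z * z^* = (Re z ^+ 2 + Im z ^+ 2)%:C.
Proof. by case: z => a b; apply: complex_eqP => /=; ring. Qed.

Lemma Cintegral_sqr_ge0 (l : R) (y : R -> C) :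
  0 <= Cintegral `[0, l] (fun t => y t * (y t)^*).
Proof.
rewrite lecE /=; apply/andP; split.
  apply/eqP; rewrite (@eq_Rintegral _ _ _ _ _ (fun=> 0)).
    by rewrite /Rintegral; under eq_integral do rewrite /=; rewrite integral0.
  by move=> x _; rewrite mul_conjc_re.
apply: Rintegral_ge0 => x _; rewrite mul_conjc_re /=.
by rewrite addr_ge0 ?sqr_ge0.
Qed.

Lemma Cintegral_sqr_eq0 (l : R) (y : R -> C) : bounded_measurable l y ->
  Cintegral `[0, l] (fun t => y t * (y t)^*) = 0 ->
  {ae mu, forall x, `[0, l]%classic x -> y x = 0}.
Proof.
move=> [my1 my2 [M yM]] [+ _].
pose f x := Re (y x) ^+ 2 + Im (y x) ^+ 2.
have mf : measurable_fun `[0, l] f by apply: measurable_funD; exact: measurable_funX.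
have -> : \int[mu]_(x in `[0, l]) Re (y x * (y x)^*) = \int[mu]_(x in `[0, l]) f x.
  by apply: eq_Rintegral => x _; rewrite mul_conjc_re.
have f_ge0 x : 0 <= f x by rewrite addr_ge0 ?sqr_ge0.
have fint : mu.-integrable `[0, l] (EFin \o f).
  apply: measurable_bounded_integrable => //; first exact: mu_itv_lty.
  exists (`|M| ^+ 2 + `|M| ^+ 2); split; first exact: num_real.
  move=> N MN x xl /=; rewrite ger0_norm//; apply: le_trans (ltW MN).
  have yx : `|Re (y x)| <= `|M| /\ `|Im (y x)| <= `|M|.
    split; apply: le_trans (ler_norm M); rewrite -lecR.
    - exact: le_trans (norm_Re_le _) (yM _ xl).
    - exact: le_trans (norm_Im_le _) (yM _ xl).
  by rewrite /f -(real_normK (num_real (Re _))) -(real_normK (num_real (Im _)));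
    rewrite lerD ?lerXn2r ?nnegrE ?yx.1 ?yx.2.
move=> If0.
have If : (\int[mu]_(x in `[0%R, l]) `|(EFin \o f) x| = 0)%E.
  under eq_integral do rewrite /= ger0_norm//.
  by rewrite -[LHS]fineK ?integrable_fin_num//; congr (_%:E).
have mEf : measurable_fun `[0%R, l]%classic (EFin \o f) by exact/measurable_EFinP.
have H' : {ae mu, forall x, `[0, l]%classic x -> (f x)%:E = 0%E}.
  by move/(ae_eq_integral_abs mu (measurable_itv _) mEf) : If.
apply: ae_imply H' => x + xl => /(_ xl) [] /eqP.
rewrite paddr_eq0 ?sqr_ge0// !sqrf_eq0 => /andP[/eqP re0 /eqP im0].
exact: complex_eqP.
Qed.

End EdgeSolutions.

(** * Exponential decay on the lead *)

Section Lead.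
Variables (R : realType).
Local Notation mu := (@lebesgue_measure R).
Local Notation C := R[i].
Local Notation Re := complex.Re.
Local Notation Im := complex.Im.
Implicit Types (k l : R).

Let expk_derive k x : is_derive x (1 : R) (fun t => expR (k * t)) (k * expR (k * x)).
Proof. by apply: is_derive_eq; rewrite /GRing.scale /= mulr1 mulrC. Qed.

Let expk_continuous k : continuous (fun t : R => expR (k * t)).
Proof.
move=> x; apply: differentiable_continuous; apply/derivable1_diffP.
by have [] := expk_derive k x.
Qed.

Lemma expR_density k l :
  has_density l (fun x => expR (k * x)) (fun x => k * expR (k * x)).
Proof.
have cf : continuous (fun t : R => k * expR (k * t)).
  by move=> x; apply: cvgM; [exact: cvg_cst|exact: expk_continuous].
have ci (x : R) : {within `[0, x], continuous (fun t : R => k * expR (k * t))}.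
  exact: continuous_subspaceT.
split; first by apply: continuous_compact_integrable => //; exact: segment_compact.
move=> x; rewrite in_itv/= => /andP[]; rewrite le_eqVlt => /predU1P[<- _|x0 _].
  by rewrite set_itv1 Rintegral_set1 addr0.
have := @continuous_FTC2 _ (fun t : R => k * expR (k * t)) (fun t => expR (k * t)) 0 x x0
  (ci x).
move=> E; rewrite /Rintegral E; first by rewrite -EFinB /= addrC subrK.
  split=> [t _||].
  - by have [] := expk_derive k t.
  - by apply: cvg_at_right_filter; exact: expk_continuous.
  - by apply: cvg_at_left_filter; exact: expk_continuous.
by move=> t _; rewrite derive1E; have [] := expk_derive k t.
Qed.

Lemma expR_cdensity k l :
  cdensity l (fun x => (expR (k * x))%:C) (fun x => k%:C * (expR (k * x))%:C).
Proof.
split; first by apply: has_density_congr (expR_density k l) => // x;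
  rewrite complex_ReM /= mul0r subr0.
have d0 : has_density l (fun=> 0 : R) (fun=> 0).
  by apply: has_density_congr (has_densityZ 0 (expR_density k l)) => x; rewrite mul0r.
by apply: has_density_congr d0 => // x; rewrite complex_ImM /= mulr0 mul0r addr0.
Qed.

Lemma L2_real_itv_bounded (f : R -> R) l : L2_real `[0, +oo[ f -> L2_real `[0, l] f.
Proof.
move=> [mf if2]; have sub : `[0, l] `<=` `[(0:R), +oo[ by exact: subset_itvl.
split; first exact: measurable_funS mf.
exact: integrableS if2.
Qed.

Lemma H2_itv_bounded (y dy ddy : R -> C) l :
  H2 `[0, +oo[ y dy ddy -> H2 `[0, l] y dy ddy.
Proof.
have sub : `[0, l] `<=` `[(0:R), +oo[ by exact: subset_itvl.
case=> [[a1 a2] [b1 b2] [c1 c2] y0 y1].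
by split=> [| | |x xl|x xl];
  [split|split|split|apply: y0; exact: sub|apply: y1; exact: sub];
  exact: L2_real_itv_bounded.
Qed.

(** In absolute value, a multiple of e^(k x) is at least its value at 0, and a nonzero
constant is not square integrable on a half-line. *)
Lemma L2_real_growing (f : R -> R) k : 0 <= k -> L2_real `[0, +oo[ f ->
  (forall x, 0 <= x -> f x = f 0 * expR (k * x)) -> f 0 = 0.
Proof.
move=> k0 [mf if2] fE; apply/eqP/negPn/negP => f0.
have : mu.-integrable `[0%R, +oo[ (EFin \o cst (f 0 ^+ 2)).
  apply: le_integrable if2 => //.
    by apply/measurable_EFinP; exact: measurable_cst.
  move=> x xp; have x0 : 0 <= x by move: xp; rewrite /= in_itv/= andbT.
  rewrite lee_fin !ger0_norm ?sqr_ge0// (fE x x0) exprMn ler_peMr ?sqr_ge0//.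
  by rewrite exprn_ege1// -expR0 ler_expR mulr_ge0.
move/integrableP => [_]; rewrite (_ : (fun x => _) = cst ((f 0 ^+ 2)%:E)); last first.
  by apply/funext => x /=; rewrite ger0_norm ?sqr_ge0.
have muE : mu `[0%R, +oo[%classic = +oo%E.
  by rewrite lebesgue_measure_itv /= ltry.
have I : (\int[mu]_(x in `[0%R, +oo[) cst (f 0 ^+ 2)%:E x =
    (f 0 ^+ 2)%:E * mu `[0%R, +oo[%classic)%E by exact: integral_cst.
rewrite I muE.
by rewrite gt0_muley ?ltxx// lte_fin exprn_even_gt0.
Qed.

(** From y'' = k^2 y one gets (y' + k y)' = k (y' + k y), so y' + k y is a multiple of
e^(k x); as it is square integrable it vanishes, and y' = - k y. *)
Lemma lead_decay (y dy ddy : R -> C) k : 0 < k -> H2 `[0, +oo[ y dy ddy ->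
  {ae mu, forall x, `[0, +oo[%classic x -> ddy x = (k ^+ 2)%:C * y x} ->
  dy 0 = - k%:C * y 0 /\ forall x, 0 <= x -> y x = y 0 * (expR (- k * x))%:C.
Proof.
move=> k0 H yE; have yd l := (H2_density (H2_itv_bounded l H)).
pose e (x : R) : C := (expR (- k * x))%:C.
have eK x : e x * (expR (k * x))%:C = 1.
  by rewrite /e -rmorphM -expRD mulNr addNr expR0.
have e0 : e 0 = 1 by rewrite /e mulr0 expR0.
have const l (f df : R -> C) : 0 <= l -> cdensity l f df ->
    {ae mu, forall x, `[0, l]%classic x -> df x = 0} -> f l = f 0.
  move=> l0 fd dae.
  have i0 : cintegrable `[0, l] (fun=> (0 : C)).
    by apply: bm_integrable; split=> //=; exists 0 => x _; rewrite normr0.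
  have [_ ->] := (cdensityP _ _ _).1 (cdensity_ae i0 dae fd); last first.
    by rewrite in_itv/= l0 lexx.
  rewrite [Cintegral _ _](_ : _ = 0) ?addr0//.
  by congr (_ +i* _) => /=; rewrite /Rintegral; under eq_integral do rewrite /=;
    rewrite integral0.
pose u x := dy x + k%:C * y x.
have uE x : 0 <= x -> u x = u 0 * (expR (k * x))%:C.
  move=> x0; have [y0 y1] := yd x.
  have ud := cdensityM (expR_cdensity (- k) x) (cdensityD y1 (cdensityZ k%:C y0)).
  have := const x _ _ x0 ud; rewrite -/(e x) -/(e 0) -/(u x) -/(u 0) e0 mul1r => <-.
    by rewrite mulrAC eK mul1r.
  apply: ae_imply yE => t + tx => -> //=.
    by rewrite rmorphN rmorphXn /=; ring.
  by move: tx; rewrite /= !in_itv/= andbT => /andP[].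
have uL : L2_complex `[0, +oo[ u.
  by case: H => yL dyL _ _ _; apply: L2_complexD => //; exact: L2_complexZ.
have u0 : u 0 = 0.
  apply: complex_eqP; case: uL => ur ui.
  - apply: (L2_real_growing (f := fun x => Re (u x)) (ltW k0) ur) => x x0.
    by rewrite uE// complex_ReM /= mulr0 subr0.
  - apply: (L2_real_growing (f := fun x => Im (u x)) (ltW k0) ui) => x x0.
    by rewrite uE// complex_ImM /= mulr0 add0r.
have dyE x : 0 <= x -> dy x = - k%:C * y x.
  by move=> x0; apply/eqP; rewrite mulNr -addr_eq0 -/(u x) uE// u0 mul0r.
split; first exact: dyE.
move=> x x0; have [y0 _] := yd x.
have yd' := cdensityM (expR_cdensity k x) y0.
have := const x _ _ x0 yd'; rewrite mulr0 expR0 mul1r => <-.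
  by rewrite mulrAC [X in X * _]mulrC eK mul1r.
apply: aeW => t; rewrite /= in_itv/= => /andP[t0 _]; rewrite dyE//; ring.
Qed.

Lemma L2_real_expR k : 0 < k -> L2_real `[0, +oo[ (fun x => expR (- k * x)).
Proof.
move=> k0; split.
  by apply: measurable_funTS; apply: measurableT_comp => //; exact: measurable_funM.
have k20 : 0 < 2 * k by rewrite mulr_gt0.
have := integral_exponential_pdf k20; have mE := measurable_exponential_pdf (2 * k).
have := exponential_pdf_ge0 (ltW k20) => pdf0.
move=> I1; have iE : mu.-integrable setT (EFin \o exponential_pdf (2 * k)).
  apply/integrableP; split; first exact/measurable_EFinP.
  under eq_integral do rewrite /= ger0_norm//.
  by rewrite I1 ltry.
have iE' : mu.-integrable `[0, +oo[ (EFin \o exponential_pdf (2 * k)).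
  exact: integrableS iE.
apply: integrable_congr (integrable_scale (2 * k)^-1 _ iE') => // x.
rewrite mem_setE in_itv/= andbT => x0; rewrite exponential_pdfE//.
rewrite mulrA mulVf ?gt_eqF// mul1r expr2 -expRD; congr expR; ring.
Qed.

Lemma lead_H2 (a : C) k : 0 < k ->
  H2 `[0, +oo[ (fun x => a * (expR (- k * x))%:C)
    (fun x => a * ((- k)%:C * (expR (- k * x))%:C))
    (fun x => a * ((- k)%:C * ((- k)%:C * (expR (- k * x))%:C))).
Proof.
move=> k0; have eL : L2_complex `[0, +oo[ (fun x => (expR (- k * x))%:C).
  split; first exact: L2_real_expR.
  by apply: L2_real_congr (L2_realZ 0 _ (L2_real_expR k0)) => // x; rewrite mul0r.
have E l := expR_cdensity (- k) l.
split; try by do ?[apply: L2_complexZ => //].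
- move=> x /=; rewrite in_itv/= andbT => x0.
  by have [_ ->] := (cdensityP _ _ _).1 (cdensityZ a (E x)); rewrite ?in_itv/= ?x0 ?lexx.
- move=> x /=; rewrite in_itv/= andbT => x0.
  by have [_ ->] := (cdensityP _ _ _).1 (cdensityZ a (cdensityZ (- k)%:C (E x)));
    rewrite ?in_itv/= ?x0 ?lexx.
Qed.

End Lead.

(** * Rooted trees *)

Section Tree.
Variables (p : nat) (T : rooted_tree p).
Local Notation g := p.-1.
Local Notation root := (tree_root T).
Local Notation d := (degree root).

Lemma tgt_neq_root j : tgt T j != root.
Proof.
by have [s [_ _]] := tree_away T j; rewrite inE negb_or eq_sym => /andP[].
Qed.

Lemma degree_le : (d <= g)%N.
Proof. by rewrite -[X in (_ <= X)%N]card_ord; exact: max_card. Qed.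

Lemma src_rootE j : (src T j == root) = (j < d)%N.
Proof. exact: tree_root_first. Qed.

(** If two edges entered v, their initial vertices would both be reachable from
the root without passing through v, and a path joining them would close up
through v to a cycle. *)
Lemma tgt_inj : injective (tgt T).
Proof.
move=> j k jk; apply/eqP/negPn/negP => jNk.
pose v := tgt T j; pose e := tree_adj (src T) (tgt T).
pose e' := [rel u w | [&& e u w, u != v & w != v]].
have e_sym : symmetric e.
  by move=> u w; apply/existsP/existsP; case=> i ei; exists i; rewrite orbC.
have e'_sym : symmetric e'.
  by move=> u w; rewrite /e' /= e_sym [(u != v) && _]andbC.
have avoid i : tgt T i = v -> connect e' root (src T i).
  move=> iv; have [s [es ls]] := tree_away T i; rewrite iv => vs.
  apply/connectP; exists s => //; elim: s root es vs {ls} => //= x s IH u.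
  move=> /andP[eux es]; rewrite inE negb_or => /andP[vu vxs].
  rewrite (IH x es vxs) andbT; apply/and3P; split=> //; first by rewrite eq_sym.
  by move: vxs; rewrite inE negb_or eq_sym => /andP[].
have /connectP[s0 es0 ls0] : connect e' (src T j) (src T k).
  apply: connect_trans (avoid k (esym jk)).
  by rewrite (sym_connect_sym e'_sym) avoid.
have [s [es us ls]] : exists s, [/\ path e' (src T j) s, uniq (src T j :: s)
    & src T k = last (src T j) s].
  by case/shortenP: es0 ls0 => s es us _ ls; exists s.
have sN : src T j != src T k.
  apply: contra jNk => /eqP ejk; apply/eqP; apply: (@tree_no_parallel _ T).
  by rewrite ejk jk.
have evj : e v (src T j) by apply/existsP; exists j; rewrite !eqxx orbT.
have ekv : e (src T k) v by apply/existsP; exists k; rewrite -jk !eqxx.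
have cyc : ucycle e (v :: src T j :: s).
  rewrite /ucycle /= rcons_path evj -ls ekv andbT.
  rewrite (sub_path _ es)/=; last by move=> u w /and3P[].
  rewrite [_ && uniq s]us andbT inE negb_or eq_sym tree_no_loop /=.
  apply/negP => vs; have : all (fun w => w != v) s.
    elim: s (src T j) es {us ls vs} => //= x s IH u /andP[/and3P[_ _ ->]] /=.
    exact: IH.
  by move/allP => /(_ v vs); rewrite eqxx.
have := tree_acyclic cyc; rewrite /= !ltnS leqn0 size_eq0 => /eqP s_nil.
by move: sN; rewrite ls s_nil eqxx.
Qed.

(** By counting: the p - 1 edges have distinct terminal vertices among the p - 1
vertices other than the root. *)
Lemma tgt_surj v : v != root -> exists j, tgt T j = v.
Proof.
move=> vr.
have sub : [set tgt T j | j : 'I_g]%SET \subset [set~ root]%SET.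
  by apply/fintype.subsetP => _ /imsetP[j _ ->]; rewrite !inE tgt_neq_root.
have : v \in [set tgt T j | j : 'I_g]%SET.
  have /eqP -> : [set tgt T j | j : 'I_g]%SET == [set~ root]%SET.
    by rewrite eqEcard sub card_imset ?card_ord; last exact: tgt_inj;
       rewrite cardsC1 card_vertex /=.
  by rewrite !inE.
by case/imsetP => j _ ->; exists j.
Qed.

Lemma degree_gt0 : (2 <= p)%N -> (0 < d)%N.
Proof.
move=> p2; have : (1 < #|{: vertex T}|)%N by rewrite card_vertex.
case/card_gt1P => u [w [_ _ uw]].
have [v vr] : exists v, v != root.
  by have [e|] := eqVneq u root; [exists w; rewrite -e eq_sym|exists u].
have /connectP[[|x s] /= es ls] := tree_connected root v.
  by rewrite ls eqxx in vr.
case/andP: es => /existsP[j /orP[]/andP[/eqP sj /eqP tj]] _.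
  by rewrite (leq_trans _ (_ : (j < d)%N))// -src_rootE sj.
by have := tgt_neq_root j; rewrite tj eqxx.
Qed.

Lemma sum_incoming (V : nmodType) (F : 'I_g -> V) j v : tgt T j = v ->
  \sum_(i | tgt T i == v) F i = F j.
Proof.
move=> <-; apply: big_pred1 => i /=.
by apply/eqP/eqP => [/tgt_inj|->].
Qed.

Lemma sum_outgoing (V : nmodType) (F : 'I_g -> V) :
  \sum_j \sum_(k | src T k == tgt T j) F k = \sum_(k | src T k != root) F k.
Proof.
rewrite (exchange_big_dep (fun k => src T k != root)) /=; last first.
  by move=> j k _ /eqP ->; exact: tgt_neq_root.
apply: eq_bigr => k /tgt_surj[j jk].
under eq_bigl do rewrite eq_sym.
by rewrite (sum_incoming (fun=> F k) jk).
Qed.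

(** Green's formula on the tree. At an inner vertex both functions are continuous and
their outgoing derivatives add up to the incoming one, so the Wronskian at the end
of an edge is the sum of those at the beginning of the edges that follow; only the
root is left. *)
Lemma green_tree (K : comNzRingType) (u0 ul du0 dul z0 zl dz0 dzl : 'I_g -> K) :
  (forall j k, tgt T j = src T k -> ul j = u0 k) ->
  (forall j, dul j = \sum_(k | src T k == tgt T j) du0 k) ->
  (forall j k, tgt T j = src T k -> zl j = z0 k) ->
  (forall j, dzl j = \sum_(k | src T k == tgt T j) dz0 k) ->
  \sum_j ((ul j * dzl j - dul j * zl j) - (u0 j * dz0 j - du0 j * z0 j)) =
  \sum_(k | src T k == root) (du0 k * z0 k - u0 k * dz0 k).
Proof.
move=> cu ku cz kz; rewrite sumrB.
have -> : \sum_j (ul j * dzl j - dul j * zl j) =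
    \sum_j \sum_(k | src T k == tgt T j) (u0 k * dz0 k - du0 k * z0 k).
  apply: eq_bigr => j _; rewrite ku kz mulr_sumr mulr_suml -sumrB.
  by apply: eq_bigr => k /eqP kj; rewrite (cu j k)// (cz j k).
rewrite sum_outgoing [X in _ - X](bigID (fun k => src T k == root)) /=.
rewrite opprD addrCA subrr addr0 -sumrN.
by apply: eq_bigr => k _; rewrite opprB.
Qed.
End Tree.

(** * Determinants and kernels *)

Section RowOperations.
Variables (K : comNzRingType) (n : nat).
Implicit Types (f : 'I_n -> 'rV[K]_n).

Lemma det_row_linear f fb fc i (b c : K) :
  f i = b *: fb i + c *: fc i ->
  (forall k, k != i -> fb k = f k) -> (forall k, k != i -> fc k = f k) ->
  \det (\matrix_k f k) = b * \det (\matrix_k fb k) + c * \det (\matrix_k fc k).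
Proof.
move=> fi fbE fcE; apply: (@determinant_multilinear _ _ _ _ _ i).
- by rewrite !rowK.
- by apply/matrixP => k m; rewrite !mxE fbE// eq_sym neq_lift.
- by apply/matrixP => k m; rewrite !mxE fcE// eq_sym neq_lift.
Qed.

(** The map (x, y) |-> (x - y, x) on two rows has determinant 1. *)
Lemma det_sub_swap f f' i j : i != j -> f' i = f i - f j -> f' j = f i ->
  (forall k, k != i -> k != j -> f' k = f k) ->
  \det (\matrix_k f' k) = \det (\matrix_k f k).
Proof.
move=> ij f'i f'j f'E.
pose fb k := if k == i then f i else f' k; pose fc k := if k == i then f j else f' k.
rewrite (@det_row_linear f' fb fc i 1 (-1)); last 3 first.
- by rewrite /fb /fc eqxx f'i scale1r scaleN1r.
- by move=> k /negbTE ki; rewrite /fb ki.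
- by move=> k /negbTE ki; rewrite /fc ki.
rewrite (@determinant_alternate _ _ _ i j ij); last first.
  by move=> k; rewrite !mxE /fb eqxx eq_sym (negbTE ij) f'j.
have -> : \matrix_k fc k = xrow i j (\matrix_k f k).
  apply/matrixP => k m; rewrite !mxE /fc.
  case: tpermP => [->|->|/eqP ki /eqP kj]; rewrite ?eqxx//.
  - by rewrite eq_sym (negbTE ij) f'j.
  - by rewrite (negbTE ki) f'E.
rewrite xrowE det_mulmx /tperm_mx det_perm odd_tperm ij expr1 mulN1r mulr0.
by rewrite add0r mulN1r opprK.
Qed.
End RowOperations.

Section KernelFactor.
Variables (F : fieldType) (n : nat) (M0 : 'M[F]_n).
Local Notation r := (\rank M0).

(* The first r columns of U span a complement of the kernel of M0, the others the
   kernel. *)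
Let U := invmx (row_ebase M0).

Let U_unit : U \in unitmx. Proof. by rewrite unitmx_inv row_ebase_unit. Qed.

Let M0U : M0 *m U = col_ebase M0 *m pid_mx r.
Proof. by rewrite -{1}(mulmx_ebase M0) mulmxK// row_ebase_unit. Qed.

Definition range_columns : 'M[F]_n := U *m pid_mx r.
Definition kernel_columns : 'M[F]_n := U *m copid_mx r.

Lemma mulmx_kernel_columns : M0 *m kernel_columns = 0.
Proof. by rewrite mulmxA M0U -mulmxA mul_pid_mx_copid// ?rank_leq_row// mulmx0. Qed.

Lemma det_pid_copid (t : F) :
  \det (pid_mx r + t *: copid_mx r : 'M[F]_n) = t ^+ (n - r).
Proof.
have rn : (r <= n)%N := rank_leq_row M0.
pose e i := if (i < r)%N then 1 else t.
have -> : pid_mx r + t *: copid_mx r = diag_mx (\row_(i < n) e i).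
  apply/matrixP => i j; rewrite !mxE /e; have [->|ij] := eqVneq i j.
    by case: ifP; rewrite ?eqxx /= ?subrr ?mulr0 ?addr0// subr0 mulr1 add0r.
  by rewrite (negbTE (_ : (i : nat) != j)) ?mulr0n ?subr0 ?mulr0 ?addr0.
rewrite det_diag; under eq_bigr do rewrite mxE.
rewrite -(big_mkord xpredT e) (big_cat_nat (n := r))//=.
rewrite big_nat big1 => [|i /andP[_ ir]]; last by rewrite /e ir.
rewrite mul1r big_nat (eq_bigr (fun=> t)) => [|i /andP[ri _]].
  by rewrite -big_nat prodr_const_nat.
by rewrite /e ltnNge ri.
Qed.

(** On the kernel of M0, M is t N; so the n - r columns of M U that come from the kernel
are divisible by t. *)
Lemma det_kernel_factor (M N : 'M[F]_n) t : M = M0 + t *: N ->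
  \det U * \det M =
  t ^+ (n - r) * \det (M *m range_columns + N *m kernel_columns).
Proof.
move=> ME; have rn : (r <= n)%N := rank_leq_row M0.
rewrite mulrC -det_mulmx -det_pid_copid mulrC -det_mulmx; congr (\det _).
have split1 : pid_mx r + copid_mx r = 1%:M :> 'M[F]_n by rewrite addrC subrK.
have kc : M *m U *m copid_mx r = t *: (N *m U *m copid_mx r).
  rewrite ME mulmxDl mulmxDl -(mulmxA M0) mulmx_kernel_columns add0r.
  by rewrite -!scalemxAl.
rewrite mulmxDl !mulmxDr !mulmxA -!scalemxAr.
rewrite -!(mulmxA _ (pid_mx r)) -!(mulmxA _ (copid_mx r)) pid_mx_id//.
rewrite mul_pid_mx_copid// mul_copid_mx_pid// copid_mx_id// !mulmx0.
rewrite scaler0 addr0 add0r -kc -mulmxDr split1.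
by rewrite mulmx1.
Qed.

Lemma det_ebase_neq0 : \det U != 0.
Proof. by rewrite -unitfE -[_ \is a _]/(U \in unitmx). Qed.

(** A vector x killed by this matrix splits into v in the kernel of M0 and w in
the complement with N v + M0 w = 0. The hypothesis gives v = 0, then M0 w = 0,
so w = 0. *)
Lemma det_kernel_factor_neq0 (N : 'M[F]_n) :
  (forall v w : 'cV[F]_n, M0 *m v = 0 -> N *m v + M0 *m w = 0 -> v = 0) ->
  \det (M0 *m range_columns + N *m kernel_columns) != 0.
Proof.
move=> simple; have rn : (r <= n)%N := rank_leq_row M0.
rewrite -det_tr; apply/det0P => -[v v0 /(congr1 trmx)].
rewrite trmx_mul trmxK trmx0; set x := v^T => Px.
have kx : kernel_columns *m x = 0.
  apply: (simple _ (range_columns *m x)).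
    by rewrite mulmxA mulmx_kernel_columns mul0mx.
  by rewrite addrC [M0 *m _]mulmxA [N *m _]mulmxA -mulmxDl.
have cx : copid_mx r *m x = 0.
  by rewrite -(mulKmx U_unit (copid_mx r *m x)) [U *m _]mulmxA kx mulmx0.
have px : pid_mx r *m x = 0 :> 'cV[F]_n.
  move: Px; rewrite mulmxDl -[N *m _ *m _]mulmxA kx mulmx0 addr0.
  have -> : M0 *m range_columns = col_ebase M0 *m pid_mx r.
    by rewrite mulmxA M0U -mulmxA pid_mx_id.
  rewrite -mulmxA.
  by move/(congr1 (mulmx (invmx (col_ebase M0)))); rewrite mulKmx ?col_ebase_unit// mulmx0.
have x0 : x = 0.
  by rewrite -[x]mul1mx -[1%:M](subrK (pid_mx r)) mulmxDl cx px addr0.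
by case/eqP: v0; rewrite -[v]trmxK -/x x0 trmx0.
Qed.

Lemma kernel_basis : exists b : 'I_(n - r) -> 'cV[F]_n,
  [/\ forall i, M0 *m b i = 0,
      forall a : 'I_(n - r) -> F, \sum_i a i *: b i = 0 -> forall i, a i = 0
    & forall v, M0 *m v = 0 -> exists a : 'I_(n - r) -> F, v = \sum_i a i *: b i].
Proof.
have <- : \rank (kermx M0^T) = (n - r)%N by rewrite mxrank_ker mxrank_tr.
pose B := row_base (kermx M0^T).
have sumE (a : 'I_(\rank (kermx M0^T)) -> F) :
    \sum_i a i *: (row i B)^T = (\row_i a i *m B)^T.
  rewrite mulmx_sum_row linear_sum; apply: eq_bigr => i _.
  by rewrite linearZ /= mxE.
exists (fun i => (row i B)^T); split.
- move=> i; apply: trmx_inj; rewrite trmx_mul trmxK trmx0; apply/sub_kermxP.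
  by rewrite (submx_trans (row_sub _ _))// eq_row_base.
- move=> a; rewrite sumE => /(congr1 trmx); rewrite trmxK trmx0 => aB i.
  have /rowP/(_ i) : \row_i a i = 0.
    by apply: (row_free_inj (row_base_free _)); rewrite mul0mx.
  by rewrite !mxE.
- move=> v M0v; have : (v^T <= B)%MS.
    by rewrite eq_row_base; apply/sub_kermxP; rewrite -trmx_mul M0v trmx0.
  case/submxP => D vE; exists (fun i => D 0 i); rewrite sumE.
  by rewrite -[LHS]trmxK vE; congr (_ *m _)^T; apply/rowP => i; rewrite mxE.
Qed.

End KernelFactor.

(** * The Jost function as one determinant *)

Section JostMatrix.
Variables (R : realType) (p : nat) (T : rooted_tree p).
Local Notation g := p.-1.
Local Notation C := R[i].
Local Notation d := (degree (tree_root T)).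
Local Notation ca := (coef_a R p).
Local Notation cb := (coef_b R p).
Hypothesis p_ge2 : (2 <= p)%N.

Definition phi_row (root_row : nat -> 'rV[C]_(g + g)) (c dc s ds : 'I_g -> C)
    (i : 'I_(g + g)) : 'rV[C]_(g + g) :=
  match fintype.split i with
  | inl k => if (k < d)%N then root_row k else continuity_row T c s k
  | inr j => kirchhoff_row T dc ds j
  end.

Lemma PhiE root_row c dc s ds :
  Phi T root_row c dc s ds = \matrix_i phi_row root_row c dc s ds i.
Proof. by apply/matrixP => i n; rewrite !mxE. Qed.

(** With continuity at the root, the last row is the condition sum_k y_k'(0) + i
zeta y(0) = 0 that e^(i zeta x) on the lead imposes. *)
Definition jost_root_row (zeta : C) (k : nat) : 'rV[C]_(g + g) :=
  if (k.+1 < d)%N then ca 0 - ca k.+1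
  else \sum_(n < d) cb n + ((0 +i* 1) * zeta) *: ca 0.

Let root_index t (td : (t < d)%N) : 'I_(g + g) :=
  lshift g (Ordinal (leq_trans td (degree_le T))).

Let phi_row_root root_row c dc s ds t (td : (t < d)%N) :
  phi_row root_row c dc s ds (root_index td) = root_row t.
Proof. by rewrite /phi_row (unsplitK (inl _)) /= td. Qed.

Let phi_row_other f f' c dc s ds t (td : (t < d)%N) i :
  (forall k, (k < d)%N -> k != t -> f' k = f k) -> i != root_index td ->
  phi_row f' c dc s ds i = phi_row f c dc s ds i.
Proof.
move=> ff' it; rewrite /phi_row; case: fintype.splitP => // k ik.
case: ifP => // kd; apply: ff' => //; apply: contra it => /eqP kt.
by apply/eqP/val_inj; rewrite /= ik.
Qed.

(* The root rows a_0 - a_1, ..., a_0 - a_t, a_0, a_(t+1), ..., between the Dirichlet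
   rows (t = 0) and rows that agree with the standard ones but for the last. *)
Let stage t k := if (k < t)%N then ca 0 - ca k.+1 else if k == t then ca 0 else ca k.

Let det_stage c dc s ds t : (t < d)%N ->
  \det (Phi T (stage t) c dc s ds) = \det (Phi T (dirichlet_root_row R p) c dc s ds).
Proof.
elim: t => [|t IH] td.
  congr (\det (Phi T _ c dc s ds)); apply/funext => k.
  by rewrite /stage ltn0; case: eqP => // ->.
rewrite -IH ?(ltnW td)// !PhiE.
apply: (@det_sub_swap _ _ _ _ (root_index (ltnW td)) (root_index td)).
- by apply/eqP => /(congr1 val) /= /n_Sn.
- by rewrite !phi_row_root /stage ltnSn ltnn eqxx ltnNge leqnSn /= gtn_eqF.
- by rewrite !phi_row_root /stage !ltnn !eqxx.
move=> i it it1; rewrite /phi_row; case: fintype.splitP => // k ik.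
case: ifP => // kd; rewrite /stage ltnS.
have kt : (k : nat) != t.
  by apply: contra it => /eqP kt; apply/eqP/val_inj; rewrite /= ik.
have kt1 : (k : nat) != t.+1.
  by apply: contra it1 => /eqP kt1; apply/eqP/val_inj; rewrite /= ik.
by rewrite leq_eqVlt (negbTE kt) (negbTE kt1).
Qed.

(** Both determinants have the root rows a_0 - a_1, ..., a_0 - a_(d-1) and
differ in the row that follows, in which the determinant is linear. *)
Lemma jost_det l (sigma : 'S_(g + g)) (c dc s ds : 'I_g -> C -> R -> C) zeta :
  jost T l sigma c dc s ds zeta =
  (-1) ^+ sigma * \det (Phi T (jost_root_row zeta)
    (fun j => c j (zeta ^+ 2) l) (fun j => dc j (zeta ^+ 2) l)
    (fun j => s j (zeta ^+ 2) l) (fun j => ds j (zeta ^+ 2) l)).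
Proof.
rewrite /jost /phi_N /phi_D /phi !row_permE !det_mulmx !det_perm.
set c' := fun j => c j _ l; set dc' := fun j => dc j _ l.
set s' := fun j => s j _ l; set ds' := fun j => ds j _ l.
have d0 := degree_gt0 T p_ge2; have dd : (d.-1 < d)%N by rewrite prednK.
rewrite mulrCA -mulrDr; congr (_ * _); rewrite -(det_stage _ _ _ _ dd).
rewrite !PhiE [RHS](@det_row_linear _ _ _
  (phi_row (standard_root_row R T) c' dc' s' ds')
  (phi_row (stage d.-1) c' dc' s' ds') (root_index dd) 1 ((0 +i* 1) * zeta)).
- by rewrite mul1r.
- rewrite !phi_row_root /jost_root_row /standard_root_row /stage prednK// ltnn.
  by rewrite leqNgt dd eqxx scale1r.
- move=> k kd; apply: phi_row_other kd => {}k kd kd1.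
  have k1 : (k.+1 < d)%N by rewrite -ltn_predRL ltn_neqAle kd1 -ltnS prednK.
  by rewrite /jost_root_row /standard_root_row k1.
- move=> k kd; apply: phi_row_other kd => {}k kd kd1.
  have k1 : (k.+1 < d)%N by rewrite -ltn_predRL ltn_neqAle kd1 -ltnS prednK.
  by rewrite /jost_root_row /stage k1 ltn_predRL k1.
Qed.

End JostMatrix.

(** * The linear system at the vertices *)

Section VertexSystem.
Variables (R : realType) (p : nat) (T : rooted_tree p).
Local Notation g := p.-1.
Local Notation C := R[i].
Local Notation d := (degree (tree_root T)).
Local Notation ca := (coef_a R p).
Local Notation cb := (coef_b R p).
Hypothesis p_ge2 : (2 <= p)%N.
Implicit Types (v w : 'cV[C]_(g + g)).

(** The entries a_k = y_k(0) and b_k = y_k'(0) of a vector of unknowns. *)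
Definition init_val v (k : 'I_g) : C := v (lshift g k) 0.
Definition init_der v (k : 'I_g) : C := v (rshift g k) 0.

(** The part of [phi_row] that is linear in the end values, with i a_0 for the
derivative of the last root row in zeta: the difference quotient of the matrix. *)
Definition slope_row (c dc s ds : 'I_g -> C) (i : 'I_(g + g)) : 'rV[C]_(g + g) :=
  match fintype.split i with
  | inl k => if (k < d)%N then (if (k.+1 < d)%N then 0 else (0 +i* 1) *: ca 0)
             else \sum_(j | tgt T j == src T k) end_form c s j
  | inr j => end_form dc ds j
  end.

Definition slope_mx c dc s ds : 'M[C]_(g + g) := \matrix_i slope_row c dc s ds i.

Lemma Phi_slope zeta t (c dc s ds Gc Gdc Gs Gds : 'I_g -> C) :
  Phi T (jost_root_row T (zeta + t)) (fun j => c j + t * Gc j)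
    (fun j => dc j + t * Gdc j) (fun j => s j + t * Gs j) (fun j => ds j + t * Gds j) =
  Phi T (jost_root_row T zeta) c dc s ds + t *: slope_mx Gc Gdc Gs Gds.
Proof.
have endE (u v Gu Gv : 'I_g -> C) j : end_form (fun j => u j + t * Gu j)
    (fun j => v j + t * Gv j) j = end_form u v j + t *: end_form Gu Gv j.
  by rewrite /end_form !scalerDl scalerDr !scalerA addrACA.
rewrite !PhiE; apply/row_matrixP => i; rewrite linearD linearZ /= !rowK.
rewrite /phi_row /slope_row; case: fintype.split => k; last first.
  by rewrite /kirchhoff_row endE addrAC.
case: ifP => kd; last first.
  rewrite /continuity_row (eq_bigr _ (fun j _ => endE c s Gc Gs j)) big_split /=.
  by rewrite -scaler_sumr addrAC.
rewrite /jost_root_row; case: ifP => _; first by rewrite scaler0 addr0.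
by rewrite mulrDr scalerDl addrA scalerA [t * _]mulrC.
Qed.

Let appE v (n : 'I_(g + g)) (r : 'rV[C]_(g + g)) :
  r = delta_mx 0 n -> (r *m v) 0 0 = v n 0.
Proof. by move=> ->; rewrite -rowE mxE. Qed.

Lemma mul_coef_a v (k : 'I_g) : (ca k *m v) 0 0 = init_val v k.
Proof. by apply: appE; apply/rowP => i; rewrite !mxE eqxx. Qed.

Lemma mul_coef_b v (k : 'I_g) : (cb k *m v) 0 0 = init_der v k.
Proof. by apply: appE; apply/rowP => i; rewrite !mxE eqxx. Qed.

Let appD (r r' : 'rV[C]_(g + g)) v : ((r + r') *m v) 0 0 = (r *m v) 0 0 + (r' *m v) 0 0.
Proof. by rewrite mulmxDl mxE. Qed.

Let appB (r r' : 'rV[C]_(g + g)) v : ((r - r') *m v) 0 0 = (r *m v) 0 0 - (r' *m v) 0 0.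
Proof. by rewrite mulmxBl !mxE. Qed.

Let appZ k (r : 'rV[C]_(g + g)) v : ((k *: r) *m v) 0 0 = k * (r *m v) 0 0.
Proof. by rewrite -scalemxAl mxE. Qed.

Let app_sum (I : finType) (P : pred I) (r : I -> 'rV[C]_(g + g)) v :
  ((\sum_(i | P i) r i) *m v) 0 0 = \sum_(i | P i) (r i *m v) 0 0.
Proof. by rewrite mulmx_suml summxE. Qed.

Lemma mul_end_form (u v : 'I_g -> C) w j :
  (end_form u v j *m w) 0 0 = u j * init_val w j + v j * init_der w j.
Proof. by rewrite appD !appZ mul_coef_a mul_coef_b. Qed.

(** The value at l of y_j = a_j c_j + b_j s_j if u and v are the values at l of c_j and
s_j, and likewise for the derivatives. *)
Definition end_val (u v : 'I_g -> C) w (j : 'I_g) : C :=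
  u j * init_val w j + v j * init_der w j.

Variable k0 : 'I_g.
Hypothesis k0E : k0 = 0%N :> nat.

Let ca0 v : (ca 0 *m v) 0 0 = init_val v k0.
Proof. by rewrite -mul_coef_a k0E. Qed.

(** The vertex conditions for a Jordan chain: at the inner vertices they are
those of a function with initial data w whose end values are shifted by the
contribution of v. For v = 0 this describes the kernel. *)
Lemma vertex_systemP zeta (Gc Gdc Gs Gds c dc s ds : 'I_g -> C) v w :
  slope_mx Gc Gdc Gs Gds *m v + Phi T (jost_root_row T zeta) c dc s ds *m w = 0 <->
  [/\ forall j k, tgt T j = src T k ->
        end_val Gc Gs v j + end_val c s w j = init_val w k,
      forall j, end_val Gdc Gds v j + end_val dc ds w j =
        \sum_(k | src T k == tgt T j) init_der w k,
      forall k, src T k = tree_root T -> init_val w k = init_val w k0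
    & \sum_(k | src T k == tree_root T) init_der w k +
      (0 +i* 1) * zeta * init_val w k0 + (0 +i* 1) * init_val v k0 = 0].
Proof.
have d0 := degree_gt0 T p_ge2.
set X := _ + _; have Xi i : X i 0 = (slope_row Gc Gdc Gs Gds i *m v) 0 0 +
    (phi_row T (jost_root_row T zeta) c dc s ds i *m w) 0 0.
  rewrite /X PhiE mxE -[slope_row _ _ _ _ i](rowK _ i) -[phi_row _ _ _ _ _ _ i](rowK _ i).
  by rewrite -!row_mul !mxE.
have Xr j : X (rshift g j) 0 = end_val Gdc Gds v j + end_val dc ds w j -
    \sum_(k | src T k == tgt T j) init_der w k.
  rewrite Xi /slope_row /phi_row !(unsplitK (inr _)) mul_end_form /kirchhoff_row.
  rewrite appB mul_end_form app_sum addrA; congr (_ - _).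
  by apply: eq_bigr => k _; exact: mul_coef_b.
have Xl j k : tgt T j = src T k -> X (lshift g k) 0 =
    end_val Gc Gs v j + end_val c s w j - init_val w k.
  move=> jk; have kd : (k < d)%N = false.
    by rewrite -src_rootE -jk (negbTE (tgt_neq_root _ _)).
  rewrite Xi /slope_row /phi_row !(unsplitK (inl _)) kd /continuity_row.
  by rewrite !(sum_incoming _ jk) appB !mul_end_form mul_coef_a addrA.
have sum_root : \sum_(n < d) (cb n *m w) 0 0 =
    \sum_(k | src T k == tree_root T) init_der w k.
  rewrite (big_ord_widen g (fun n => (cb n *m w) 0 0) (degree_le T)).
  by apply: eq_big => [k|k _]; rewrite ?src_rootE ?mul_coef_b.
have Xroot k (kd : (k < g)%N) : (k < d)%N -> X (lshift g (Ordinal kd)) 0 =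
    if (k.+1 < d)%N then init_val w k0 - (ca k.+1 *m w) 0 0 else
     \sum_(k | src T k == tree_root T) init_der w k +
      (0 +i* 1) * zeta * init_val w k0 + (0 +i* 1) * init_val v k0.
  move=> kd'; rewrite Xi /slope_row /phi_row !(unsplitK (inl _)) /= kd' /jost_root_row.
  case: ifP => _; first by rewrite mul0mx mxE add0r appB ca0.
  by rewrite appD !appZ !ca0 app_sum sum_root addrC.
split=> [X0|[cont kirch root_cont root_der]].
  split.
  - by move=> j k jk; apply/subr0_eq; rewrite -Xl// X0 mxE.
  - by move=> j; apply/subr0_eq; rewrite -Xr X0 mxE.
  - move=> [k kg] /eqP; rewrite src_rootE /=; case: k kg => [|k] kg kd.
      by congr (init_val w _); apply: val_inj; rewrite /= k0E.
    have := Xroot k (ltnW kg) (ltnW kd); rewrite kd X0 mxE => /esym/subr0_eq ->.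
    by rewrite -(mul_coef_a w (Ordinal kg)).
  - have dd : (d.-1 < d)%N by rewrite prednK.
    have := Xroot d.-1 (leq_trans dd (degree_le T)) dd.
    by rewrite (_ : (d.-1.+1 < d)%N = false) ?X0 ?mxE// (ltn_predK d0) ltnn.
apply/colP => i; rewrite [RHS]mxE; case: (split_ordP i) => k ->; last first.
  by rewrite Xr kirch subrr.
have [kr|] := eqVneq (src T k) (tree_root T); last first.
  by move=> /tgt_surj[j jk]; rewrite (Xl j)// (cont j k jk) subrr.
have kd : (k < d)%N by rewrite -src_rootE kr.
have -> : k = Ordinal (ltn_ord k) by apply: val_inj.
rewrite Xroot//=; case: ifP => // kd1.
have kg := leq_trans kd1 (degree_le T).
have /eqP r1 : src T (Ordinal kg) == tree_root T by rewrite src_rootE.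
by rewrite -(root_cont _ r1) -(mul_coef_a w (Ordinal kg)) subrr.
Qed.

End VertexSystem.

(** * Eigenfunctions and the order of the zero *)

(** Green's identity for u = duhamel c s y, which solves - u'' + q u - nu u = y with
zero initial data, read off from the explicit formula. *)
Lemma duhamel_green (R : realType) (l : R) q nu (c dc s ds y z dz : R -> R[i]) :
  0 <= l -> fundamental_system l q nu c dc s ds -> bounded_measurable l y ->
  schrodinger_solution l q nu z dz ->
  duhamel c s y l * dz l - duhamel' c s dc ds y l * z l =
  Cintegral `[0, l] (fun t => y t * z t).
Proof.
move=> l0 fs yb zs; have ll : l \in `[0, l] by rewrite in_itv/= l0 lexx.
case: (fs) => -[cs c0 dc0] [ss s0 ds0].
have yc := bm_integrable (bmM yb (solution_bm l0 cs)).
have ys := bm_integrable (bmM yb (solution_bm l0 ss)).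
have -> : Cintegral `[0, l] (fun t => y t * z t) =
    z 0 * Cintegral `[0, l] (fun t => y t * c t) +
    dz 0 * Cintegral `[0, l] (fun t => y t * s t).
  rewrite -!CintegralZ// -CintegralD//; try exact: cintegrableZ.
  apply: eq_Cintegral => t; rewrite mem_setE => tl.
  by have [-> _] := solution_fundamental l0 fs zs tl; ring.
have := wronskianE l0 cs zs ll; have := wronskianE l0 ss zs ll.
rewrite c0 dc0 s0 ds0 subrr !mul0r !addr0 mul1r sub0r subr0 mul1r => Es Ec.
rewrite /duhamel /duhamel'; set Is := Cintegral _ _; set Ic := Cintegral _ _.
transitivity (Is * (c l * dz l - dc l * z l) - Ic * (s l * dz l - ds l * z l)).
  by ring.
by rewrite Es Ec; ring.
Qed.

Lemma root_multiplicity_cdiff (K : numFieldType) (E h : K -> K) z0 n :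
  (forall z, cdiff h z) -> h z0 != 0 -> (forall z, E z = (z - z0) ^+ n * h z) ->
  root_multiplicity E z0 n.
Proof.
move=> dh h0 EE; exists h; split=> //; apply: (@nearW _ _ _ (nbhs_filter z0)) => z //.
exact: cdiff_derivable.
Qed.

Section Main.
Variables (R : realType) (p : nat) (T : rooted_tree p) (l : R).
Local Notation g := p.-1.
Local Notation C := R[i].
Local Notation mu := (@lebesgue_measure R).
Local Notation ii := (0 +i* 1 : C).
Variables (q : 'I_g -> R -> R) (c dc s ds : 'I_g -> C -> R -> C).
Variables (kap : R).
Hypotheses (p_ge2 : (2 <= p)%N) (l0 : 0 < l) (kap0 : 0 < kap).
Hypothesis fs : forall j lam, fundamental_system l (q j) lam
  (c j lam) (dc j lam) (s j lam) (ds j lam).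
Implicit Types (v w : 'cV[C]_(g + g)).

(* zeta_0 = i kap, where e^(i zeta_0 x) = e^(- kap x). *)
Let lam0 : C := (- kap ^+ 2)%:C.
Let zeta0 : C := 0 +i* kap.
Let l_ge0 : 0 <= l := ltW l0.
Let ll : l \in `[0, l]. Proof. by rewrite in_itv/= l_ge0 lexx. Qed.

Let g0 : (0 < g)%N. Proof. by case: (p) p_ge2 => [|[]]. Qed.
Let k0 : 'I_g := Ordinal g0.
Let src_k0 : src T k0 = tree_root T.
Proof. by apply/eqP; rewrite src_rootE /= degree_gt0. Qed.

Let izeta0 : ii * zeta0 = (- kap)%:C.
Proof. by apply: complex_eqP => /=; ring. Qed.

Let M0 := Phi T (jost_root_row T zeta0) (fun j => c j lam0 l) (fun j => dc j lam0 l)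
    (fun j => s j lam0 l) (fun j => ds j lam0 l).

(** k0 is the first edge, which leaves the root, so that init_val v k0 is the value at
the root. *)
Definition mode v : edge_family R p := fun k x =>
  if k is Some j then init_val v j * c j lam0 x + init_der v j * s j lam0 x
  else init_val v k0 * (expR (- kap * x))%:C.

Let dmode v (j : 'I_g) x := init_val v j * dc j lam0 x + init_der v j * ds j lam0 x.

Let mode_sol v j : schrodinger_solution l (q j) lam0 (mode v (Some j)) (dmode v j).
Proof. by case: (fs j lam0) => -[cs _ _] [ss _ _]; exact: solution_combination. Qed.

Let mode0 v j : mode v (Some j) 0 = init_val v j /\ dmode v j 0 = init_der v j.
Proof.
case: (fs j lam0) => -[_ c0 dc0] [_ s0 ds0].
by rewrite /mode /dmode c0 dc0 s0 ds0; split; ring.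
Qed.

Lemma mode_kerP v : M0 *m v = 0 <->
  [/\ forall j k, tgt T j = src T k -> mode v (Some j) l = init_val v k,
      forall j, dmode v j l = \sum_(k | src T k == tgt T j) init_der v k,
      forall k, src T k = tree_root T -> init_val v k = init_val v k0
    & \sum_(k | src T k == tree_root T) init_der v k = kap%:C * init_val v k0].
Proof.
have v0E u u' (j : 'I_g) : end_val u u' (0 : 'cV[C]_(g + g)) j = 0.
  by rewrite /end_val /init_val /init_der !mxE !mulr0 addr0.
have E j : end_val (fun j => c j lam0 l) (fun j => s j lam0 l) v j = mode v (Some j) l.
  by rewrite /end_val /mode mulrC [s _ _ _ * _]mulrC.
have dE j : end_val (fun j => dc j lam0 l) (fun j => ds j lam0 l) v j = dmode v j l.
  by rewrite /end_val /dmode mulrC [ds _ _ _ * _]mulrC.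
have := @vertex_systemP R p T p_ge2 k0 erefl zeta0 (fun=> 0) (fun=> 0) (fun=> 0) (fun=> 0)
  (fun j => c j lam0 l) (fun j => dc j lam0 l) (fun j => s j lam0 l)
  (fun j => ds j lam0 l) 0 v.
have i0 : init_val (0 : 'cV[C]_(g + g)) k0 = 0 by rewrite /init_val mxE.
rewrite mulmx0 add0r -/M0 i0 mulr0 addr0 izeta0 => H.
split=> [/H[h1 h2 h3 h4]|[h1 h2 h3 h4]].
- split=> // [j k jk|j|].
  + by rewrite -(h1 j k jk) v0E add0r E.
  + by rewrite -h2 v0E add0r dE.
  + by move: h4; rewrite rmorphN mulNr => /subr0_eq.
- apply/H; split=> // [j k jk|j|].
  + by rewrite -(h1 j k jk) v0E add0r E.
  + by rewrite -h2 v0E add0r dE.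
  + by rewrite h4 rmorphN mulNr subrr.
Qed.

(** The vector v consists of the initial data of y on the edges. *)
Lemma ker_mode y : Linfty_ker T l q lam0 y ->
  exists v, [/\ M0 *m v = 0,
    forall j x, x \in `[0, l] -> y (Some j) x = mode v (Some j) x
    & forall x, 0 <= x -> y None x = mode v None x].
Proof.
move=> [dy [ddy [yH [ycont ykir] [rcont rkir] yE]]].
pose v : 'cV[C]_(g + g) := \col_i match fintype.split i with
  | inl k => y (Some k) 0 | inr k => dy (Some k) 0 end.
have vE k : init_val v k = y (Some k) 0.
  by rewrite /init_val mxE (unsplitK (inl _)).
have dvE k : init_der v k = dy (Some k) 0.
  by rewrite /init_der mxE (unsplitK (inr _)).
have ys j : schrodinger_solution l (q j) lam0 (y (Some j)) (dy (Some j)).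
  exists (ddy (Some j)); split; first exact: (yH (Some j)).
  by apply: ae_imply (yE (Some j)) => x + xl => /(_ xl) ->.
have yfs j x : x \in `[0, l] ->
    y (Some j) x = mode v (Some j) x /\ dy (Some j) x = dmode v j x.
  move=> xl; have [-> ->] := solution_fundamental l_ge0 (fs j lam0) (ys j) xl.
  by rewrite /mode /dmode vE dvE.
have leadE : {ae mu, forall x, `[0, +oo[%classic x ->
    ddy None x = (kap ^+ 2)%:C * y None x}.
  apply: ae_imply (yE None) => x + xl => /(_ xl) /= /eqP.
  rewrite mul0r addr0 -eqr_oppLR => /eqP <-.
  by rewrite /lam0 rmorphN mulNr opprK.
have [dlead lead] := lead_decay kap0 (yH None) leadE.
exists v; split.
- apply/mode_kerP; split.
  + by move=> j k /ycont E; rewrite vE -E; have [-> _] := yfs j l ll.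
  + move=> j; have [_ <-] := yfs j l ll; rewrite ykir.
    by apply: eq_bigr => k _; rewrite dvE.
  + by move=> k kr; rewrite !vE -rcont// -rcont.
  + rewrite (eq_bigr _ (fun k _ => dvE k)); apply/eqP.
    by rewrite -subr_eq0 vE -(rcont k0)// addrC -mulNr -dlead rkir.
- by move=> j x xl; have [] := yfs j x xl.
- by move=> x x0; rewrite lead// /mode vE (rcont k0).
Qed.

Lemma mode_ker v : M0 *m v = 0 -> Linfty_ker T l q lam0 (mode v).
Proof.
move=> /mode_kerP[cont kir rcont rkir].
have [ddm ddmE] := choice (fun j => mode_sol v j).
pose a := init_val v k0; pose e (x : R) : C := (expR (- kap * x))%:C.
exists (fun k x => if k is Some j then dmode v j x else a * ((- kap)%:C * e x)).
exists (fun k x => if k is Some j then ddm j x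
                   else a * ((- kap)%:C * ((- kap)%:C * e x))).
have e0 : e 0 = 1 by rewrite /e mulr0 expR0.
split.
- by case=> [j|]; [have [] := ddmE j|exact: lead_H2].
- split=> [j k jk|j]; first by rewrite (cont j k jk) (mode0 v k).1.
  by rewrite kir; apply: eq_bigr => k _; rewrite (mode0 v k).2.
- split=> [k kr|]; first by rewrite (mode0 v k).1 rcont// /mode -/(e 0) e0 mulr1.
  rewrite (eq_bigr _ (fun k _ => (mode0 v k).2)) rkir -/a e0 mulr1 rmorphN.
  by rewrite mulrN mulrC addNr.
case=> [j|]; last first.
  apply: aeW => x _; rewrite /mode -/(e x) -/a /= mul0r addr0 /lam0 rmorphN rmorphXn.
  by rewrite rmorphN; ring.
by have [_ E] := ddmE j; apply: ae_imply E => x + xl => /(_ xl) ->.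
Qed.

Lemma mode_ae0 v : edge_ae_eq l (mode v) (fun _ _ => 0) -> v = 0.
Proof.
move=> ae0; have v0 j : init_val v j = 0 /\ init_der v j = 0.
  have [<- <-] := mode0 v j.
  exact: (solution_ae0 l0 (mode_sol v j) (ae0 (Some j))).
apply/colP => i; rewrite [RHS]mxE; case: (split_ordP i) => j ->.
- exact: (v0 j).1.
- exact: (v0 j).2.
Qed.

Lemma mode_sum (m : nat) (b : 'I_m -> 'cV[C]_(g + g)) a k x :
  mode (\sum_i a i *: b i) k x = lincomb (fun i => mode (b i)) a k x.
Proof.
have E (n : 'I_(g + g)) : (\sum_i a i *: b i) n 0 = \sum_i a i * b i n 0.
  by rewrite summxE; apply: eq_bigr => i _; rewrite mxE.
rewrite /lincomb /mode /init_val /init_der; case: k => [j|]; rewrite !E !mulr_suml.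
  by rewrite -big_split /=; apply: eq_bigr => i _; rewrite mulrDr !mulrA.
by apply: eq_bigr => i _; rewrite mulrA.
Qed.

Lemma ker_dim : Linfty_ker_dim T l q lam0 (g + g - \rank M0).
Proof.
have [b [b0 bfree bspan]] := kernel_basis M0.
exists (fun i => mode (b i)); split.
- by move=> i; exact: mode_ker.
- move=> a; have -> : lincomb (fun i => mode (b i)) a = mode (\sum_i a i *: b i).
    by apply/funext => k; apply/funext => x; rewrite mode_sum.
  by move/mode_ae0; exact: bfree.
- move=> y /ker_mode[v [/bspan[a ->] yj y0]]; exists a => -[j|]; apply: aeW => x.
  + by move=> xl; rewrite yj// mode_sum.
  + by move=> x0; rewrite y0 ?mode_sum//; move: x0; rewrite /= in_itv/= andbT.
Qed.

(* The difference quotients in zeta, at zeta0, of c_j, c_j', s_j, s_j' at l; the factor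
   zeta + zeta0 comes from lam - lam0 = (zeta - zeta0) (zeta + zeta0). *)
Let Gc j zeta := (zeta + zeta0) * duhamel (c j lam0) (s j lam0) (c j (zeta ^+ 2)) l.
Let Gdc j zeta := (zeta + zeta0) *
  duhamel' (c j lam0) (s j lam0) (dc j lam0) (ds j lam0) (c j (zeta ^+ 2)) l.
Let Gs j zeta := (zeta + zeta0) * duhamel (c j lam0) (s j lam0) (s j (zeta ^+ 2)) l.
Let Gds j zeta := (zeta + zeta0) *
  duhamel' (c j lam0) (s j lam0) (dc j lam0) (ds j lam0) (s j (zeta ^+ 2)) l.
Let N zeta := slope_mx T (Gc^~ zeta) (Gdc^~ zeta) (Gs^~ zeta) (Gds^~ zeta).

Let zeta0_sqr : zeta0 ^+ 2 = lam0.
Proof. by rewrite /lam0; apply: complex_eqP => /=; ring. Qed.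

Let sol_c j lam : schrodinger_solution l (q j) lam (c j lam) (dc j lam).
Proof. by case: (fs j lam) => -[]. Qed.
Let sol_s j lam : schrodinger_solution l (q j) lam (s j lam) (ds j lam).
Proof. by case: (fs j lam) => _ []. Qed.
Let c0 j lam : c j lam 0 = 1. Proof. by case: (fs j lam) => -[]. Qed.
Let dc0 j lam : dc j lam 0 = 0. Proof. by case: (fs j lam) => -[]. Qed.
Let s0 j lam : s j lam 0 = 0. Proof. by case: (fs j lam) => _ []. Qed.
Let ds0 j lam : ds j lam 0 = 1. Proof. by case: (fs j lam) => _ []. Qed.

Lemma Phi_expansion zeta :
  Phi T (jost_root_row T zeta) (fun j => c j (zeta ^+ 2) l) (fun j => dc j (zeta ^+ 2) l)
    (fun j => s j (zeta ^+ 2) l) (fun j => ds j (zeta ^+ 2) l) =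
  M0 + (zeta - zeta0) *: N zeta.
Proof.
have sq : zeta ^+ 2 - lam0 = (zeta - zeta0) * (zeta + zeta0).
  by rewrite -zeta0_sqr subr_sqr.
have zE : zeta0 + (zeta - zeta0) = zeta by rewrite addrC subrK.
have Ec j := parameter_expansion l_ge0 (fs j lam0) (sol_c j) (c0 j) (dc0 j) (zeta ^+ 2) ll.
have Es j := parameter_expansion l_ge0 (fs j lam0) (sol_s j) (s0 j) (ds0 j) (zeta ^+ 2) ll.
have E1 j : c j (zeta ^+ 2) l = c j lam0 l + (zeta - zeta0) * Gc j zeta.
  by rewrite (Ec j).1 sq -mulrA.
have E2 j : dc j (zeta ^+ 2) l = dc j lam0 l + (zeta - zeta0) * Gdc j zeta.
  by rewrite (Ec j).2 sq -mulrA.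
have E3 j : s j (zeta ^+ 2) l = s j lam0 l + (zeta - zeta0) * Gs j zeta.
  by rewrite (Es j).1 sq -mulrA.
have E4 j : ds j (zeta ^+ 2) l = ds j lam0 l + (zeta - zeta0) * Gds j zeta.
  by rewrite (Es j).2 sq -mulrA.
by rewrite (funext E1) (funext E2) (funext E3) (funext E4) -{1}zE Phi_slope.
Qed.

Lemma slope_cdiff zeta i n : cdiff (fun z => N z i n) zeta.
Proof.
have sqr_cdiff z : cdiff (fun w : C => w ^+ 2) z.
  exact: (cdiffM (cdiff_id z) (cdiff_id z)).
have F j (Y dY : C -> R -> C) (y0 y1 : C) (L : (R -> C) -> C) :
    (forall lam, schrodinger_solution l (q j) lam (Y lam) (dY lam)) ->
    (forall lam, Y lam 0 = y0) -> (forall lam, dY lam 0 = y1) ->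
    bounded_functional l L ->
    cdiff (fun z => (z + zeta0) * L (Y (z ^+ 2))) zeta.
  move=> Ys Y0 dY0 bL; apply: cdiffM.
    by apply: cdiffD; [exact: cdiff_id|exact: cdiff_cst].
  apply: (@cdiff_comp _ (fun lam => L (Y lam)) (fun z => z ^+ 2)) => //.
  exact: (functional_cdiff l_ge0 (fs j _) Ys Y0 dY0 bL).
have bL j := duhamel_functional l_ge0 (fs j lam0) ll.
have bL' j := duhamel'_functional l_ge0 (fs j lam0) ll.
have dGc j := F j _ _ _ _ _ (sol_c j) (c0 j) (dc0 j) (bL j).
have dGdc j := F j _ _ _ _ _ (sol_c j) (c0 j) (dc0 j) (bL' j).
have dGs j := F j _ _ _ _ _ (sol_s j) (s0 j) (ds0 j) (bL j).
have dGds j := F j _ _ _ _ _ (sol_s j) (s0 j) (ds0 j) (bL' j).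
have end_cdiff (u u' : 'I_g -> C -> C) j : cdiff (u j) zeta -> cdiff (u' j) zeta ->
    cdiff (fun z => end_form (u^~ z) (u'^~ z) j 0 n) zeta.
  move=> du du'; rewrite (_ : (fun z => _) = fun z =>
    u j z * coef_a R p j 0 n + u' j z * coef_b R p j 0 n).
    by apply: cdiffD; apply: cdiffM => //; exact: cdiff_cst.
  by apply/funext => z; rewrite !mxE.
rewrite (_ : (fun z => _) =
  fun z => slope_row T (Gc^~ z) (Gdc^~ z) (Gs^~ z) (Gds^~ z) i 0 n); last first.
  by apply/funext => z; rewrite mxE.
rewrite /slope_row; case: (fintype.split i) => k.
  2: exact: (end_cdiff Gdc Gds k (dGdc k) (dGds k)).
case: (k < degree (tree_root T))%N; first exact: cdiff_cst.
under eq_fun do rewrite summxE.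
by apply: cdiff_sum => j _; exact: (end_cdiff Gc Gs j (dGc j) (dGs j)).
Qed.

(** Green's formula for the chain and the conjugate of y = mode v gives
2 kap sum_j int |y_j|^2 + |y(v_0)|^2 = 0, a sum of nonnegative terms. *)
Lemma no_jordan_chain v w : M0 *m v = 0 -> N zeta0 *m v + M0 *m w = 0 -> v = 0.
Proof.
move=> /mode_kerP[vc vk vr vd] /(@vertex_systemP R p T p_ge2 k0 erefl)[wc wk wr wd].

pose y j := mode v (Some j).
pose I j := Cintegral `[0, l] (fun t => y j t * (y j t)^*).
have zs j : schrodinger_solution l (q j) lam0 (fun t => (y j t)^*) (fun t => (dmode v j t)^*).
  exact: (solution_conj (mode_sol v j)).
have yb j : bounded_measurable l (y j) by exact: solution_bm (mode_sol v j).
have lin j L : bounded_functional l L -> L (y j) = init_val v j * L (c j lam0) +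
    init_der v j * L (s j lam0).
  move=> [Llin _]; have bc := solution_bm l_ge0 (sol_c j lam0).
  have bs := solution_bm l_ge0 (sol_s j lam0).
  have L0 f : bounded_measurable l f -> forall k, L (fun x => k * f x) = k * L f.
    move=> bf k; have -> : (fun x => k * f x) = fun x => f x + (k - 1) * f x.
      by apply/funext => x; ring.
    by rewrite Llin//; ring.
  by rewrite /y /mode Llin ?L0//; exact: bmZ.
have bL j := duhamel_functional l_ge0 (fs j lam0) ll.
have bL' j := duhamel'_functional l_ge0 (fs j lam0) ll.
have GE j : end_val (Gc^~ zeta0) (Gs^~ zeta0) v j =
    2 * zeta0 * duhamel (c j lam0) (s j lam0) (y j) l.
  by rewrite (lin j _ (bL j)) /end_val /Gc /Gs zeta0_sqr; ring.
have dGE j : end_val (Gdc^~ zeta0) (Gds^~ zeta0) v j = 2 * zeta0 *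
    duhamel' (c j lam0) (s j lam0) (dc j lam0) (ds j lam0) (y j) l.
  by rewrite (lin j _ (bL' j)) /end_val /Gdc /Gds zeta0_sqr; ring.
have green := green_tree (z0 := fun j => (init_val v j)^*)
  (dz0 := fun j => (init_der v j)^*) (zl := fun j => (y j l)^*)
  (dzl := fun j => (dmode v j l)^*) wc wk.
have {green} := green (fun j k jk => congr1 (@conjc R) (vc j k jk)).
have vk' j : (dmode v j l)^* = \sum_(k | src T k == tgt T j) (init_der v k)^*.
  by rewrite vk rmorph_sum.
move/(_ vk').
have -> : \sum_(k | src T k == tree_root T)
    (init_der w k * (init_val v k)^* - init_val w k * (init_der v k)^*) =
    - ii * (init_val v k0 * (init_val v k0)^*).
  rewrite (eq_bigr (fun k => (init_val v k0)^* * init_der w k -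
      init_val w k0 * (init_der v k)^*)); last first.
    by move=> k /eqP kr; rewrite (vr k kr) (wr k kr) mulrC.
  have vd' : \sum_(k | src T k == tree_root T) (init_der v k)^* =
      kap%:C * (init_val v k0)^*.
    have := congr1 (@conjc R) vd; rewrite rmorph_sum => ->.
    by rewrite [LHS]rmorphM; congr (_ * _); exact: conjc_real.
  rewrite sumrB -!mulr_sumr vd'.
  have -> : \sum_(k | src T k == tree_root T) init_der w k =
      kap%:C * init_val w k0 - ii * init_val v k0.
    by move: wd; rewrite izeta0 rmorphN mulNr addrAC => /subr0_eq <-; rewrite addrK.
  by ring.
rewrite (eq_bigr (fun j => 2 * zeta0 * I j)); last first.
  move=> j _; rewrite GE dGE.
  have := duhamel_green l_ge0 (fs j lam0) (yb j) (zs j); rewrite -/(I j) => <-.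
  have := wronskianE l_ge0 (mode_sol w j) (zs j) ll.
  rewrite subrr mul0r addr0 (mode0 w j).1 (mode0 w j).2 /y (mode0 v j).1 (mode0 v j).2.
  move=> <-; rewrite -/(y j).
  have -> : end_val (fun j => c j lam0 l) (fun j => s j lam0 l) w j = mode w (Some j) l.
    by rewrite /end_val /mode mulrC [s _ _ _ * _]mulrC.
  have -> : end_val (fun j => dc j lam0 l) (fun j => ds j lam0 l) w j = dmode w j l.
    by rewrite /end_val /dmode mulrC [ds _ _ _ * _]mulrC.
  by ring.
rewrite -mulr_sumr => E.
have I0 j : 0 <= I j by exact: Cintegral_sqr_ge0.
have SI0 : 0 <= \sum_j I j by apply: sumr_ge0.
have : 2 * kap%:C * (\sum_j I j) + init_val v k0 * (init_val v k0)^* = 0.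
  have -> : 2 * kap%:C * (\sum_j I j) = - ii * (2 * zeta0 * \sum_j I j).
    have -> : zeta0 = ii * kap%:C by apply: complex_eqP => /=; ring.
    rewrite (_ : - ii * (2 * (ii * kap%:C) * \sum_j I j) =
      - (ii ^+ 2) * (2 * kap%:C * \sum_j I j)); first by rewrite sqr_i opprK mul1r.
    by ring.
  rewrite E mulrA mulNr mulrN opprK -expr2 sqr_i mulN1r addNr //.
move/eqP; rewrite paddr_eq0; last 2 first.
- by rewrite mulr_ge0// mulr_ge0// ler0c ltW.
- exact: mulcJ_ge0.
move=> /andP[+ _]; rewrite mulf_eq0 mulf_eq0 pnatr_eq0 /=.
have -> : (kap%:C == 0) = false by rewrite eq_complex /= gt_eqF.
move=> SI.
have {SI} Ij j : I j = 0.
  by move: SI; rewrite psumr_eq0// => /allP/(_ j (mem_index_enum j))/eqP.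
apply/colP => n; rewrite [RHS]mxE.
have vj j : init_val v j = 0 /\ init_der v j = 0.
  have [<- <-] := mode0 v j; apply: (solution_ae0 l0 (mode_sol v j)).
  exact: Cintegral_sqr_eq0 (yb j) (Ij j).
by case: (split_ordP n) => j ->; [exact: (vj j).1|exact: (vj j).2].
Qed.

Lemma jost_multiplicity (sigma : 'S_(g + g)) :
  root_multiplicity (jost T l sigma c dc s ds) zeta0 (g + g - \rank M0).
Proof.
pose A := range_columns M0; pose B := kernel_columns M0.
pose P z := (M0 + (z - zeta0) *: N z) *m A + N z *m B.
pose k := \det (invmx (row_ebase M0)).
have k_neq0 : k != 0 by exact: det_ebase_neq0.
apply: (root_multiplicity_cdiff (h := fun z : C => (-1) ^+ sigma / k * \det (P z))).
- move=> z; apply: cdiffM; first exact: cdiff_cst.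
  apply: cdiff_det => i j.
  have dM a b : cdiff (fun z => (M0 + (z - zeta0) *: N z) a b) z.
    rewrite (_ : (fun z => _) = fun z => M0 a b + (z + - zeta0) * N z a b); last first.
      by apply/funext => w; rewrite !mxE.
    apply: cdiffD; first exact: cdiff_cst.
    apply: cdiffM; last exact: slope_cdiff.
    by apply: cdiffD; [exact: cdiff_id|exact: cdiff_cst].
  rewrite (_ : (fun z => _) = fun z =>
    \sum_m (M0 + (z - zeta0) *: N z) i m * A m j + \sum_m N z i m * B m j); last first.
    by apply/funext => w; rewrite /P mxE [X in X + _ = _]mxE [X in _ + X = _]mxE.
  apply: cdiffD; apply: cdiff_sum => m _; apply: cdiffM;
    try exact: cdiff_cst; [exact: dM|exact: slope_cdiff].
- rewrite mulf_neq0 ?mulf_neq0 ?invr_neq0 ?signr_eq0//.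
  rewrite /P subrr scale0r addr0; apply: det_kernel_factor_neq0.
  exact: no_jordan_chain.
- move=> z; rewrite jost_det// Phi_expansion.
  have := det_kernel_factor (erefl : M0 + (z - zeta0) *: N z = M0 + (z - zeta0) *: N z).
  rewrite -/k -/(P z) => E.
  by rewrite mulrCA -E mulrA divfK.
Qed.

End Main.

Theorem theorem4p7 (R : realType) (p : nat) (T : rooted_tree p) (l : R)
    (q : 'I_p.-1 -> R -> R) (c dc s ds : 'I_p.-1 -> R[i] -> R -> R[i])
    (sigma : 'S_(p.-1 + p.-1)) (lam0 : R) (zeta0 : R[i]) :
  (2 <= p)%N -> 0 < l ->
  (forall j, L2_real `[0, l]%classic (q j)) ->
  (forall j lam, fundamental_system l (q j) lam
                   (c j lam) (dc j lam) (s j lam) (ds j lam)) ->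
  (forall i : 'I_(p.-1 + p.-1), (i < degree (tree_root T))%N -> sigma i = i) ->
  lam0 < 0 -> Linfty_eigenvalue T l q lam0%:C ->
  zeta0 ^+ 2 = lam0%:C -> 0 < complex.Im zeta0 ->
  exists m : nat, Linfty_ker_dim T l q lam0%:C m /\
    root_multiplicity (jost T l sigma c dc s ds) zeta0 m.
Proof.
move=> p2 l0 _ fs _ lam0_lt0 _; case: zeta0 => a kap zeta2 /= kap0.
have [re im] : a * a - kap * kap = lam0 /\ a * kap + kap * a = 0.
  by move: zeta2; rewrite expr2 => -[].
have a0 : a = 0.
  apply/eqP; move/eqP: im; rewrite [kap * a]mulrC -mulr2n mulrn_eq0 /= mulf_eq0.
  by rewrite (gt_eqF kap0) orbF.
have -> : lam0 = - kap ^+ 2 by rewrite -re a0; ring.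
rewrite a0; eexists; split; first exact: (@ker_dim R p T l q c dc s ds kap).
exact: (@jost_multiplicity R p T l q c dc s ds kap).
Qed.
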